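(* For every even integer $n>2$ there exists a latin square of order $n$ which has a $k$-plex for every odd integer $k$ with $\lfloor n/4\rfloor\le k\le\lceil 3n/4\rceil$, but has no $k$-plex for any odd integer $k$ outside this range.
   Context: A latin square of order $n$ is an $n\times n$ array of $n$ symbols in which each symbol occurs exactly once in each row and column. A $k$-plex in a latin square of order $n$ is a set of $kn$ cells containing exactly $k$ cells from each row, exactly $k$ cells from each column, and exactly $k$ occurrences of each symbol. *)

(* Defs.v *)
From mathcomp Require Import all_boot.
Set Implicit Arguments. Unset Strict Implicit. Unset Printing Implicit Defensive.

Definition latin_square (n : nat) (L : 'I_n -> 'I_n -> 'I_n) : Prop :=
  (forall r : 'I_n, bijective (L r)) /\
  (forall c : 'I_n, bijective (fun r => L r c)).

Definition is_kplex (n : nat) (L : 'I_n -> 'I_n -> 'I_n) (k : nat)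
    (P : {set 'I_n * 'I_n}) : Prop :=
  [/\ #|P| = k * n,
      forall r : 'I_n, #|[set c in P | c.1 == r]| = k,
      forall c : 'I_n, #|[set x in P | x.2 == c]| = k
    & forall s : 'I_n, #|[set x in P | L x.1 x.2 == s]| = k].

Definition has_kplex (n : nat) (L : 'I_n -> 'I_n -> 'I_n) (k : nat) : Prop :=
  exists P : {set 'I_n * 'I_n}, is_kplex L k P.

(* Main.v *)
(* Write n = 2h.  In any latin square on Z_n, the values s - r - c over the cells
   (r, c, s) of a k-plex with k odd sum to h, so the cyclic square s = r + c has
   no such plex.  Exchanging rows 0 and 2 in the even columns, and switching
   one further intercalate next to these rows when n = 2 mod 4, creates cells
   with s - r - c = 2 in row 0 and -2 in row 2, plus bounded corrections; over a
   k-plex the positive (and likewise the negative) part of the sum is at most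
   2k + 1, so 2k + 1 >= h.  Complementation gives the upper bound on k.

   Conversely the square is cut into "diagonals" column - row = e (with rows 0
   and 2 exchanged in even columns); a diagonal with e even and one with e odd
   form a 2-plex.  A smallest odd plex is a near transversal that uses one
   diagonal on half of the rows and the next one on the other half, together
   with pairs of diagonals e, e + 1 for e = 0, 4, 8, ... made to avoid the
   negative cells of row 2 in favour of the positive ones of row 0; neighbouring
   pairs are reconciled by exchanging two columns between two rows, and the
   symbol defects telescope from 0 to h, which is what the near transversal
   needs.  All this occupies a short range of diagonals, and the remaining ones
   are added two at a time to reach every odd k up to h. *)
Require Import Defs.
From mathcomp Require Import all_boot.
From mathcomp Require Import perm all_algebra zify ring.
Set Implicit Arguments. Unset Strict Implicit. Unset Printing Implicit Defensive.
Import GRing.Theory.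

(** * Fibre counts *)

Section CellCounts.

Variables (X T : finType).
Implicit Types (phi : X -> T) (Q : {set X}).

Definition fiber_count phi Q (z : T) : nat := \sum_(q in Q) (phi q == z).

Lemma fiber_countU phi Q1 Q2 z : [disjoint Q1 & Q2] ->
  fiber_count phi (Q1 :|: Q2) z = fiber_count phi Q1 z + fiber_count phi Q2 z.
Proof.
move=> dis; rewrite /fiber_count -bigU //.
by apply: eq_bigl => x; rewrite !inE.
Qed.

Lemma fiber_count_move phi Q x y z : x \in Q -> y \notin Q ->
  fiber_count phi (y |: Q :\ x) z + (phi x == z) =
  fiber_count phi Q z + (phi y == z).
Proof.
move=> xQ yQ; rewrite /fiber_count big_setU1 ?inE ?negb_and ?yQ ?orbT //=.
by rewrite (big_setD1 x xQ) /=; lia.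
Qed.

Lemma fiber_count_imset (I : finType) (g : I -> X) phi z : injective g ->
  fiber_count phi [set g i | i : I] z = \sum_i (phi (g i) == z).
Proof. by move=> gI; rewrite /fiber_count big_imset //= => i j _ _ /gI. Qed.

Lemma eq_fiber_count phi psi Q z : {in Q, phi =1 psi} ->
  fiber_count phi Q z = fiber_count psi Q z.
Proof. by move=> e; apply: eq_bigr => q /e ->. Qed.

Lemma fiber_count_change1 phi psi Q x z : x \in Q ->
  (forall q, q \in Q -> q != x -> phi q = psi q) ->
  fiber_count psi Q z + (phi x == z) = fiber_count phi Q z + (psi x == z).
Proof.
move=> xQ e; rewrite /fiber_count.
rewrite (big_setD1 x xQ) [in RHS](big_setD1 x xQ) /=.
have -> : \sum_(q in Q :\ x) (phi q == z) = \sum_(q in Q :\ x) (psi q == z).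
  by apply: eq_bigr => q; rewrite !inE => /andP[qx qQ]; rewrite e.
by rewrite addnC addnA addnAC.
Qed.

End CellCounts.

Lemma sum_pred1_inj (T : finType) (f : T -> T) (z : T) :
  injective f -> \sum_i (f i == z) = 1.
Proof.
move=> fI; have [g fK gK] := injF_bij fI.
rewrite (bigD1 (g z)) //= gK eqxx big1 ?addn0 // => i ne.
by case: eqP => // e; rewrite -e fK eqxx in ne.
Qed.

(** * Complements of plexes *)

Section Complement.

Variables (m : nat) (L : 'I_m -> 'I_m -> 'I_m).
Hypothesis latinL : latin_square L.

Let fiber_compl (phi : 'I_m * 'I_m -> 'I_m) (P : {set 'I_m * 'I_m}) z :
  #|[set q | phi q == z]| = m ->
  #|[set q in ~: P | phi q == z]| = m - #|[set q in P | phi q == z]|.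
Proof.
move=> full; have split_fiber : [set q | phi q == z] =
    [set q in P | phi q == z] :|: [set q in ~: P | phi q == z].
  by apply/setP => q; rewrite !inE; case: (q \in P); rewrite ?orbF.
have dis : [disjoint [set q in P | phi q == z] & [set q in ~: P | phi q == z]].
  rewrite disjoint_subset; apply/subsetP => q; rewrite !inE.
  by case/andP => ->.
have := full; rewrite split_fiber cardsU disjoint_setI0 // cards0 subn0.
by move/(congr1 (subn^~ #|[set q in P | phi q == z]|)); rewrite addKn.
Qed.

Let fiber_row (f : 'I_m -> 'I_m -> 'I_m) z : (forall r, injective (f r)) ->
  #|[set q : 'I_m * 'I_m | f q.1 q.2 == z]| = m.
Proof.
move=> fI; rewrite -sum1_card big_mkcond /=.
rewrite (eq_bigr (fun q => (f q.1 q.2 == z : nat))); last first.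
  by move=> q _; rewrite inE; case: eqP.
rewrite -(pair_bigA _ (fun r c => (f r c == z : nat))) /=.
rewrite (eq_bigr (fun=> 1)) ?sum_nat_const ?card_ord ?muln1 // => r _.
exact: sum_pred1_inj.
Qed.

Let fiber_fst (z : 'I_m) : #|[set q : 'I_m * 'I_m | q.1 == z]| = m.
Proof.
rewrite -sum1_card big_mkcond /=.
rewrite (eq_bigr (fun q => (q.1 == z : nat))); last first.
  by move=> q _; rewrite inE; case: eqP.
rewrite -(pair_bigA _ (fun r c => (r == z : nat))) exchange_big /=.
rewrite (eq_bigr (fun=> 1)) ?sum_nat_const ?card_ord ?muln1 // => c _.
exact: (sum_pred1_inj z (@inj_id _)).
Qed.

Lemma kplex_le k (P : {set 'I_m * 'I_m}) : 0 < m -> is_kplex L k P -> k <= m.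
Proof.
move=> m0 [_ rowP _ _]; rewrite -(rowP (Ordinal m0)).
apply: leq_trans (eq_leq (fiber_fst (Ordinal m0))).
by apply/subset_leq_card/subsetP => q; rewrite !inE => /andP[].
Qed.

(** Every row, column and symbol owns exactly [m] cells of the whole array, so all three counts pass
    to the complement. *)
Lemma kplex_compl k (P : {set 'I_m * 'I_m}) :
  is_kplex L k P -> is_kplex L (m - k) (~: P).
Proof.
case=> cardP rowP colP symP; split=> [|r|c|s].
- by rewrite cardsCs setCK card_prod card_ord cardP mulnBl.
- by rewrite fiber_compl ?fiber_fst // rowP.
- rewrite fiber_compl ?colP //.
  by apply: (fiber_row (f := fun _ c => c)) => r x y.
- rewrite (fiber_compl (phi := fun x => L x.1 x.2)) ?symP //.
  by apply: fiber_row => r; apply: bij_inj; apply: latinL.1.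
Qed.

End Complement.

(** * Integers modulo an even number *)

Section CyclicSquare.

Variables p h : nat.
Hypothesis nh : p.+2 = h.*2.
Hypothesis h_gt1 : 1 < h.
Notation n := p.+2.
Notation Z := 'I_p.+2.
Implicit Types (r c s x y z : Z) (q : Z * Z) (Q : {set Z * Z}).

Local Open Scope ring_scope.

Lemma val_natr (a : nat) : nat_of_ord (a%:R : Z) = (a %% n)%N.
Proof. exact: (@val_Zp_nat n). Qed.

Lemma natr_small (a : nat) : (a < n)%N -> nat_of_ord (a%:R : Z) = a.
Proof. by move=> an; rewrite val_natr modn_small. Qed.

Lemma natr_order : n%:R = 0 :> Z.
Proof. by apply/val_inj/(etrans (val_natr n)); rewrite modnn. Qed.

Lemma natr_wrap (a b : nat) : a = (b + n)%N -> a%:R = b%:R :> Z.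
Proof. by move=> ->; rewrite natrD natr_order addr0. Qed.

Lemma natr_eqE (a b : nat) : (a < n)%N -> (b < n)%N ->
  ((a%:R : Z) == b%:R) = (a == b).
Proof.
move=> an bn; apply/eqP/eqP => [/(congr1 (@nat_of_ord _))|-> //].
by rewrite !natr_small.
Qed.

Lemma val_add x y : nat_of_ord (x + y) = ((nat_of_ord x + nat_of_ord y) %% n)%N.
Proof. by []. Qed.

Lemma half_half : h%:R + h%:R = 0 :> Z.
Proof. by rewrite -natrD addnn -nh natr_order. Qed.

Definition oddZ x := odd x.

Lemma oddZD x y : oddZ (x + y) = oddZ x (+) oddZ y.
Proof. by rewrite /oddZ (val_add x y) odd_mod ?oddD // nh odd_double. Qed.

Lemma oddZ_nat (a : nat) : oddZ a%:R = odd a.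
Proof. by rewrite /oddZ val_natr odd_mod // nh odd_double. Qed.

Lemma double_eq0 x : x + x = 0 -> x = 0 \/ x = h%:R.
Proof.
move=> /(congr1 (@nat_of_ord _)); rewrite val_add [RHS]/= => e.
have xn := ltn_ord x.
have [hx|xh] := leqP h x.
  right; apply: ord_inj; rewrite natr_small; last by lia.
  have e2 : (x + x = (x + x - n) + n)%N by lia.
  by rewrite e2 modnDr modn_small in e; lia.
by left; apply: val_inj => /=; rewrite modn_small in e; lia.
Qed.

(** Doubling modulo [n] identifies exactly [x] and [x + h]. The parity of the value reveals [eps x],
    and [eps] separates these two preimages. *)
Lemma double_offset_inj (eps : Z -> bool) :
  (forall x, eps (x + h%:R) = ~~ eps x) -> injective (fun x => x + x + (eps x)%:R).
Proof.
move=> alt x y exy; have epsE : eps x = eps y.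
  have := congr1 oddZ exy; rewrite !oddZD !oddZ_nat !addbb /=.
  by case: (eps x); case: (eps y).
rewrite epsE in exy; have {}exy := addIr _ exy.
case: (@double_eq0 (x - y)) => [|/subr0_eq //|e].
  have -> : x - y + (x - y) = (x + x) - (y + y) by ring.
  by rewrite exy subrr.
have xE : x = y + h%:R by rewrite -e addrC subrK.
by move: epsE; rewrite xE alt; case: (eps y).
Qed.

Lemma lt_half_alt x : ((x + h%:R)%R < h)%N = ~~ (x < h)%N.
Proof.
rewrite val_add natr_small; last by lia.
have := ltn_ord x; have [hx xn|xh xn] := leqP h x.
  have -> : (x + h = (x + h - n) + n)%N by lia.
  by rewrite modnDr modn_small; lia.
by rewrite modn_small; lia.
Qed.

(** The values [2x] and [2x + 1], over all [x], regroup into the images of the two bijections [2x +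
    [x < h]] and [2x + [x >= h]]; each of them hits [s - e] once. *)
Lemma sum_double_pair (e s : Z) :
  (\sum_(x : Z) ((x + (x + e))%R == s) +
    \sum_(x : Z) ((x + (x + (e + 1)))%R == s) = 2)%N.
Proof.
have I1 := double_offset_inj lt_half_alt.
have I2 : injective (fun x => x + x + (~~ (x < h)%N)%:R).
  by apply: double_offset_inj => x; rewrite lt_half_alt.
have S1 := sum_pred1_inj (s - e) I1; have S2 := sum_pred1_inj (s - e) I2.
rewrite -[2%N]/(1 + 1)%N -{1}S1 -S2 -!big_split /=; apply: eq_bigr => x _.
have E (a : Z) : (x + x + a == s - e) = (x + (x + (e + a)) == s).
  by rewrite -subr_eq0 -[RHS]subr_eq0; congr (_ == 0); ring.
rewrite !E; case: (x < h)%N => /=; last by rewrite addr0.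
by rewrite addr0 addnC.
Qed.

(** * The square and its diagonals *)

Definition rowswap : {perm Z} := tperm 0 2%:R.

(* A pair [(rho, c)] stands for the cell of column [c] and symbol [rho + c] of
   the square below; [act] recovers the actual row of that cell. *)
Definition act q := if oddZ q.2 then q.1 else rowswap q.1.

Definition sym q := q.1 + q.2.

(** For a fixed column, [act] exchanges the actual row with [rho] and is an involution; hence the
    cell encoded by [q] carries the symbol [sym q]. *)
Definition base_square r c := c + act (r, c).

(* The shift by 2 keeps the labels of the cells in use from wrapping around
   modulo [n], so that they can be compared as naturals. *)
Definition label q : nat := nat_of_ord (q.2 - q.1 + 2%:R).

Lemma two_neq0 : (2%:R : Z) != 0.
Proof. by rewrite (@natr_eqE 2 0) //; lia. Qed.

Lemma rowswap_id r : r != 0 -> r != 2%:R -> rowswap r = r.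
Proof. by move=> r0 r2; rewrite /rowswap tpermD // eq_sym. Qed.

Lemma oddZ_rowswap r : oddZ (rowswap r) = oddZ r.
Proof.
have o2 : oddZ 2%:R = false by rewrite oddZ_nat.
by rewrite /rowswap; case: tpermP => [->|->|//]; rewrite o2.
Qed.

Lemma rowswap_odd r : oddZ r -> rowswap r = r.
Proof.
move=> or; apply: rowswap_id; apply/eqP => e; rewrite e ?oddZ_nat // in or.
Qed.

(** Odd rows are fixed by [rowswap], and in an even row the column has the parity of [e]. So each
    diagonal meets every actual row once. *)
Lemma act_diag r e : act (r, r + e) = if oddZ e then r else rowswap r.
Proof.
rewrite /act /= oddZD; case: (boolP (oddZ r)) => or; last by rewrite addFb.
by rewrite (rowswap_odd or) !if_same.
Qed.

Lemma act_id q : q.1 != 0 -> q.1 != 2%:R -> act q = q.1.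
Proof. by move=> r0 r2; rewrite /act rowswap_id // if_same. Qed.

Lemma labelE r c (a : nat) : c - r + 2%:R = a%:R -> (a < n)%N ->
  label (r, c) = a.
Proof. by move=> e an; rewrite /label e natr_small. Qed.

Definition diag e r : Z * Z := (r, r + e).

Lemma diag_inj e : injective (diag e).
Proof. by move=> r1 r2 []. Qed.

Lemma sum_act_diag (e z : Z) :
  (\sum_r (act (diag e r) == z) + \sum_r (act (diag (e + 1) r) == z) = 2)%N.
Proof.
have S1 := sum_pred1_inj z (@inj_id Z).
have S2 := sum_pred1_inj z (@perm_inj _ rowswap).
under eq_bigr do rewrite act_diag; rewrite addnC.
under eq_bigr do rewrite act_diag oddZD (@oddZ_nat 1) addbT; rewrite addnC.
by case: (oddZ e) => /=; rewrite S1 S2.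
Qed.

Lemma sum_snd_diag (e z : Z) : (\sum_r ((diag e r).2 == z) = 1)%N.
Proof. by apply: sum_pred1_inj => x y /= /addIr. Qed.

Definition uniform (phi : Z * Z -> Z) (k : nat) Q :=
  forall z, fiber_count phi Q z = k.

Lemma diag_pair_disjoint (e : Z) :
  [disjoint [set diag e r | r : Z] & [set diag (e + 1) r | r : Z]].
Proof.
rewrite disjoint_subset; apply/subsetP => _ /imsetP[r _ ->].
rewrite inE; apply/imsetP => -[r' _ /(congr1 (fun q => q.2 - q.1))].
rewrite /diag /= (addrC r) addrK (addrC r') addrK => /eqP.
by rewrite -subr_eq0 opprD addrA subrr sub0r oppr_eq0 oner_eq0.
Qed.

(** The diagonals [b - 2] and [b - 1] have labels [b] and [b + 1], so they avoid [Q]. Together they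
    form a 2-plex, which leaves the symbol defects [E1], [E2] unchanged. The bound by [n] stops the
    labels from wrapping around, and the last clause later locates the cells near a switched
    intercalate. *)
Lemma extend_by_diagonals (E1 E2 : Z -> nat) (j b k : nat) Q :
  uniform act k Q -> uniform snd k Q ->
  (forall s, fiber_count sym Q s + E1 s = k + E2 s)%N ->
  (forall q, q \in Q -> label q < b)%N -> (1 < b)%N -> (b + j.*2 <= n)%N ->
  exists Q', [/\ uniform act (k + j.*2) Q', uniform snd (k + j.*2) Q',
    forall s, (fiber_count sym Q' s + E1 s = k + j.*2 + E2 s)%N &
    forall q, (label q < b)%N -> (q \in Q') = (q \in Q)].
Proof.
elim: j b k Q => [|j IHj] b k Q actQ sndQ symQ labQ b_gt1 b_le.
  by exists Q; rewrite addn0.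
pose e : Z := (b - 2)%:R.
have labD r : label (diag e r) = b.
  by apply: labelE; [rewrite /e natrB //; ring | lia].
have labD1 r : label (diag (e + 1) r) = b.+1.
  by apply: labelE; [rewrite /e natrB //; ring | lia].
pose D := [set diag e r | r : Z] :|: [set diag (e + 1) r | r : Z].
have labDD q : q \in D -> (b <= label q < b.+2)%N.
  by rewrite in_setU => /orP[] /imsetP[r _ ->]; rewrite ?labD ?labD1; lia.
have disQ : [disjoint Q & D].
  rewrite disjoint_subset; apply/subsetP => q /labQ lq; rewrite inE.
  by apply/negP => /labDD; lia.
have cntD phi z : fiber_count phi (Q :|: D) z = (fiber_count phi Q z +
    (\sum_r (phi (diag e r) == z) + \sum_r (phi (diag (e + 1) r) == z)))%N.
  rewrite fiber_countU // fiber_countU ?diag_pair_disjoint //.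
  by rewrite !fiber_count_imset //; apply: diag_inj.
have [||||||Q' [actQ' sndQ' symQ' Q'Q]] := IHj b.+2 (k + 2)%N (Q :|: D).
- by move=> z; rewrite cntD sum_act_diag actQ.
- by move=> z; rewrite cntD !sum_snd_diag sndQ.
- move=> s; rewrite cntD /sym /= sum_double_pair //.
  by rewrite addnAC symQ addnAC.
- by move=> q; rewrite in_setU => /orP[/labQ|/labDD]; lia.
- by [].
- by rewrite doubleS in b_le; lia.
exists Q'; have kE : (k + j.+1.*2 = k + 2 + j.*2)%N by rewrite doubleS; lia.
rewrite kE; split=> // q lq; rewrite Q'Q; last by lia.
rewrite in_setU; case: (boolP (q \in D)) => [/labDD|_]; [lia | by rewrite orbF].
Qed.

(** * Building a smallest odd plex *)

(** The cell with [rho = 0] is moved within its column to [rho = 2]. For even [e] this trades a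
    negative cell of row 2 for a positive cell of row 0. *)
Definition bent_diag e r : Z * Z := (if r == 0 then 2%:R else r, r + e).

Lemma bent_diag_inj e : injective (bent_diag e).
Proof. by move=> r1 r2 /(congr1 snd) /addIr. Qed.

(** The two cells of a bent diagonal with [rho = 2] lie in columns of equal parity, so both are in
    row 0 (for even [e]) or both in row 2 (for odd [e]). Consecutive values of [e] compensate each
    other. *)
Lemma sum_act_bent_diag (e z : Z) :
  (\sum_r (act (bent_diag e r) == z) +
   \sum_r (act (bent_diag (e + 1) r) == z) = 2)%N.
Proof.
have S1 := sum_pred1_inj z (@inj_id Z).
have S2 := sum_pred1_inj z (@perm_inj _ rowswap).
rewrite -[2%N]/(1 + 1)%N -{1}S1 -S2 -!big_split /=; apply: eq_bigr => r _.
have odd1 x : oddZ (x + 1) = ~~ oddZ x by rewrite oddZD (@oddZ_nat 1) addbT.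
rewrite /bent_diag; case: (eqVneq r 0) => [->|r0].
  rewrite !add0r /act /= odd1 /rowswap tpermR tpermL.
  by case: (oddZ e) => //=; rewrite addnC.
by rewrite !act_diag odd1; case: (oddZ e) => //=; rewrite addnC.
Qed.

Definition delta x y : nat := x == y.
Arguments delta (x y)%_ring_scope.

Lemma sum_sym_bent_diag (e s : Z) :
  (\sum_r (sym (bent_diag e r) == s) + delta e s =
   \sum_(r : Z) ((r + (r + e))%R == s) + delta (e + 2%:R) s)%N.
Proof.
rewrite /delta (bigD1 0) //= [in RHS](bigD1 0) //= /sym /= !add0r (addrC 2%:R).
set S1 := (\sum_(i | _) _)%N; set S2 := (\sum_(i | _) _)%N.
have -> : S1 = S2.
  by apply: eq_bigr => r /negPf r0; rewrite /bent_diag r0.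
by rewrite addnC (addnC _ S2) addnA.
Qed.

Lemma sum_snd_bent_diag (e z : Z) : (\sum_r ((bent_diag e r).2 == z) = 1)%N.
Proof. exact: sum_snd_diag. Qed.

Definition block (d : nat) : {set Z * Z} :=
  [set bent_diag d%:R r | r : Z] :|: [set bent_diag (d%:R + 1) r | r : Z].

Lemma label_bent_diag (d : nat) r : (d + 2 < n)%N ->
  label (bent_diag d%:R r) = (if (r == 0)%R then d else d + 2)%N.
Proof.
move=> dn; rewrite /bent_diag; case: eqVneq => [->|r0]; apply: labelE => //.
- by rewrite add0r subrK.
- by lia.
- by rewrite natrD; ring.
Qed.

Lemma in_block (d : nat) q : (d + 3 < n)%N -> q \in block d ->
  q.1 != 0 /\ ([\/ label q = d + 2, label q = d + 3 |
    (q.1 = 2%:R)%R /\ (label q = d \/ label q = d + 1)])%N.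
Proof.
move=> dn; rewrite in_setU natr1 => /orP[] /imsetP[r _ ->] {q};
  rewrite label_bent_diag; try lia;
  rewrite /bent_diag; case: (eqVneq r 0) => [_|r0]; split=> //; try exact: two_neq0.
- by apply: Or33; split=> //; left.
- exact: Or31.
- by apply: Or33; split=> //; right; rewrite addn1.
- by apply: Or32; lia.
Qed.

Lemma block_disjoint (d : nat) : (d + 3 < n)%N ->
  [disjoint [set bent_diag d%:R r | r : Z] &
            [set bent_diag (d%:R + 1) r | r : Z]].
Proof.
move=> dn; rewrite disjoint_subset; apply/subsetP => _ /imsetP[r _ ->].
rewrite inE; apply/imsetP => -[r' _]; rewrite natr1 => /(congr1 label).
by rewrite !label_bent_diag; try lia; do 2!case: (_ == _); lia.
Qed.

Lemma fiber_count_block phi (d : nat) z : (d + 3 < n)%N ->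
  fiber_count phi (block d) z = (\sum_r (phi (bent_diag d%:R r) == z) +
    \sum_r (phi (bent_diag (d%:R + 1) r) == z))%N.
Proof.
move=> dn; rewrite fiber_countU ?block_disjoint //.
by rewrite !fiber_count_imset //; apply: bent_diag_inj.
Qed.

(** Two consecutive straight diagonals contain each symbol twice; bending moves one occurrence of
    [d] to [d + 2] and one of [d + 1] to [d + 3]. *)
Lemma fiber_count_sym_block (d : nat) s : (d + 3 < n)%N ->
  (fiber_count sym (block d) s + delta d%:R s + delta (d + 1)%:R s =
   2 + delta (d + 2)%:R s + delta (d + 3)%:R s)%N.
Proof.
move=> dn; rewrite fiber_count_block //.
have S1 := sum_sym_bent_diag d%:R s.
have S2 := sum_sym_bent_diag (d%:R + 1) s.
have S3 := sum_double_pair d%:R s.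
have -> : (d + 1)%:R = d%:R + 1 :> Z by rewrite natrD.
have -> : (d + 2)%:R = d%:R + 2%:R :> Z by rewrite natrD.
have -> : (d + 3)%:R = d%:R + 1 + 2%:R :> Z by rewrite natrD; ring.
have linear (x1 x2 y1 y2 a1 a2 b1 b2 : nat) :
    (x1 + a1 = y1 + b1 -> x2 + a2 = y2 + b2 -> y1 + y2 = 2 ->
     x1 + x2 + a1 + a2 = 2 + b1 + b2)%N by lia.
exact: linear S1 S2 S3.
Qed.

(* [Q] is the plex under construction when the blocks [d], [d + 4], ..., below
   the strand [Q0] on diagonals [f], [f + 1] have been added.  The only symbol
   defect left besides that of [Q0] is at [d]; [z0] is the exceptional cell of
   [Q0]. *)
Record chain (f : nat) (sg : Z) (z0 : Z * Z) (E1 E2 : Z -> nat) Q0 (k d : nat) Q : Prop :=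
  Chain {
  chain_act : uniform act k Q;
  chain_snd : uniform snd k Q;
  chain_sym : forall s,
    (fiber_count sym Q s + delta d%:R s + E1 s = k + E2 s)%N;
  chain_label : forall q, q \in Q -> q != z0 -> (d <= label q <= f + 3)%N;
  chain_corner : (0 < d)%N -> [/\ (sg - 1, sg + d%:R - 1) \in Q,
    (sg - 1, sg + d%:R - 2%:R) \notin Q &
    (sg + 1, sg + d%:R - 1) \notin Q];
  chain_keep : forall q, (f <= label q)%N -> q.1 != sg - 1 ->
    q != (sg + 1, sg + f%:R - 1) -> (q \in Q) = (q \in Q0) }.

(** Adding [block d] to a set that misses [d + 4] leaves [d], [d + 1], [d + 4] missing and [d + 2],
    [d + 3] in surplus. Rows [sg - 1] and [sg + 1] then exchange the columns [sg + d + 3] and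
    [sg + d + 2]: since [2 sg = 0], this removes the symbols [d + 2], [d + 3] and adds [d + 1],
    [d + 4], so that only [d] is missing. These rows differ from 0 and 2, hence [act] fixes them. *)
Lemma chain_step f sg (z0 : Z * Z) E1 E2 Q0 (k d : nat) Q :
  sg + sg = 0 -> sg - 1 != 0 -> sg - 1 != 2%:R -> sg + 1 != 0 ->
  sg + 1 != 2%:R -> (z0.1 = 0 \/ label z0 = 0%N /\ z0.1 <> 2%:R) ->
  (f + 4 <= n)%N -> (d + 4 <= f)%N ->
  chain f sg z0 E1 E2 Q0 k (d + 4) Q ->
  exists Q', chain f sg z0 E1 E2 Q0 (k + 2) d Q'.
Proof.
move=> sg2 m0 m2 p0 p2 z0P fn df [actQ sndQ symQ labQ cornQ keepQ].
have dn : (d + 3 < n)%N by lia.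
have [|a1Q b1Q b2Q] := cornQ; first by rewrite addn4.
set a1 := (sg - 1, _) in a1Q; set b1 := (sg - 1, _) in b1Q.
set b2 := (sg + 1, _) in b2Q.
pose a2 : Z * Z := (sg + 1, sg + (d + 4)%:R - 2%:R).
have La1 : label a1 = (d + 6)%N by apply: labelE; [rewrite !natrD; ring|by move: fn df; clear; lia].
have Lb1 : label b1 = (d + 5)%N by apply: labelE; [rewrite !natrD; ring|by move: fn df; clear; lia].
have La2 : label a2 = (d + 3)%N by apply: labelE; [rewrite !natrD; ring|by move: fn df; clear; lia].
have Lb2 : label b2 = (d + 4)%N by apply: labelE; [rewrite !natrD; ring|by move: fn df; clear; lia].
(* The label of [z0] can fall in the range of the block, so labels alone do not separate them. But a
   block has no cell with [rho = 0], and its labels [d], [d + 1] occur only at [rho = 2]. *)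
have zB : z0 \notin block d.
  apply/negP => /in_block-/(_ dn) [z1 labz]; case: z0P => [e|[lz z2]].
    by rewrite e eqxx in z1.
  by move: labz; rewrite lz => -[||[/z2]] //; clear; lia.
have BL q : q \in block d -> (d <= label q <= d + 3)%N.
  by move=> /in_block-/(_ dn) [_ [->|->|[_ [->|->]]]]; clear; lia.
have disQB : [disjoint Q & block d].
  rewrite disjoint_subset; apply/subsetP => q qQ; rewrite inE.
  have [->|qz] := eqVneq q z0; first exact: zB.
  by apply/negP => /BL; have := labQ _ qQ qz; clear; lia.
pose Q1 := Q :|: block d.
have a1Q1 : a1 \in Q1 by rewrite in_setU a1Q.
have b1Q1 : b1 \notin Q1.
  by rewrite in_setU (negPf b1Q) /=; apply/negP => /BL; rewrite Lb1; clear; lia.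
pose Q2 := b1 |: Q1 :\ a1.
(* The cell [a2] comes from the new block, while [a1] belongs to the part built before. *)
have a2B : a2 \in block d.
  rewrite in_setU; apply/orP; right; apply/imsetP; exists (sg + 1) => //.
  by rewrite /bent_diag (negPf p0) /a2; congr pair; rewrite natrD; ring.
have a2Q2 : a2 \in Q2.
  rewrite in_setU1 in_setD1 in_setU a2B orbT andbT; apply/orP; right.
  by apply/eqP => /(congr1 label); rewrite La1 La2; clear; lia.
have b2Q2 : b2 \notin Q2.
  rewrite in_setU1 in_setD1 in_setU (negPf b2Q) /= negb_or negb_and.
  apply/andP; split; first by apply/eqP => /(congr1 label); rewrite Lb1 Lb2; clear; lia.
  by apply/orP; right; apply/negP => /BL; rewrite Lb2; clear; lia.
pose Q3 := b2 |: Q2 :\ a2.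
have mv phi z : (fiber_count phi Q3 z + delta (phi a1) z + delta (phi a2) z =
    fiber_count phi Q z + fiber_count phi (block d) z +
    delta (phi b1) z + delta (phi b2) z)%N.
  rewrite -fiber_countU // -/Q1 [in LHS]addnAC.
  rewrite /delta fiber_count_move // addnAC fiber_count_move //.
have inQ3 q : q \in Q3 -> [\/ q = b1, q = b2, q \in Q | q \in block d].
  rewrite in_setU1 in_setD1 in_setU1 in_setD1 in_setU.
  case/orP => [/eqP|/andP[_ /orP[/eqP|/andP[_ /orP[]]]]] ?;
    by [exact: Or42|exact: Or41|exact: Or43|exact: Or44].
have act_a1 : act a1 = sg - 1 by exact: act_id.
have act_b1 : act b1 = sg - 1 by exact: act_id.
have act_a2 : act a2 = sg + 1 by exact: act_id.
have act_b2 : act b2 = sg + 1 by exact: act_id.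
exists Q3; split.
- move=> z; have := mv act z; rewrite act_a1 act_b1 act_a2 act_b2.
  rewrite fiber_count_block // sum_act_bent_diag actQ.
  by move=> /eqP; rewrite !eqn_add2r => /eqP.
- move=> z; have := mv snd z; rewrite fiber_count_block //.
  rewrite !sum_snd_bent_diag sndQ /= addnAC.
  by move=> /eqP; rewrite !eqn_add2r => /eqP.
- move=> s; have := mv sym s; have := symQ s.
  have := fiber_count_sym_block s dn.
  have linear (b q q3 k0 e1 e2 x0 x1 x2 x3 x4 : nat) :
      (b + x0 + x1 = 2 + x2 + x3 -> q + x4 + e1 = k0 + e2 ->
       q3 + x2 + x3 = q + b + x1 + x4 -> q3 + x0 + e1 = k0 + 2 + e2)%N.
    by clear; lia.
  have -> : sym a1 = (d + 2)%:R.
    by rewrite /sym /=; have := sg2; rewrite !natrD => e; ring: e.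
  have -> : sym b1 = (d + 1)%:R.
    by rewrite /sym /=; have := sg2; rewrite !natrD => e; ring: e.
  have -> : sym a2 = (d + 3)%:R.
    by rewrite /sym /=; have := sg2; rewrite !natrD => e; ring: e.
  have -> : sym b2 = (d + 4)%:R.
    by rewrite /sym /=; have := sg2; rewrite !natrD => e; ring: e.
  exact: linear.
- move=> q /inQ3[->|->|qQ|qB].
  + by rewrite Lb1 => _; move: df; clear; lia.
  + by rewrite Lb2 => _; move: df; clear; lia.
  + by move=> /(labQ _ qQ); clear; lia.
  + by move=> _; have := BL q qB; move: df; clear; lia.
(* The next corner cell is that of row [sg - 1] on the diagonal [d] of the new block. The two cells
   to be avoided have labels [d + 1] and [d], which the block has only at [rho = 2]. *)
- move=> d0; have r1 : (sg - 1, sg + d%:R - 1) \in block d.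
    rewrite in_setU; apply/orP; left; apply/imsetP; exists (sg - 1) => //.
    by rewrite /bent_diag (negPf m0); congr pair; ring.
  have L1 : label (sg - 1, sg + d%:R - 1) = (d + 2)%N.
    by apply: labelE; [rewrite !natrD; ring|by move: dn; clear; lia].
  have L2 : label (sg - 1, sg + d%:R - 2%:R) = (d + 1)%N.
    by apply: labelE; [rewrite !natrD; ring|by move: dn; clear; lia].
  have L3 : label (sg + 1, sg + d%:R - 1) = d.
    by apply: labelE; [ring|by move: dn; clear; lia].
  split.
  + rewrite in_setU1 in_setD1 in_setU1 in_setD1 in_setU r1 orbT andbT.
    apply/orP; right; apply/andP; split.
      by apply/eqP => /(congr1 label); rewrite L1 La2; clear; lia.
    by apply/orP; right; apply/eqP => /(congr1 label); rewrite L1 La1; clear; lia.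
  + apply/negP => /inQ3[/(congr1 label)|/(congr1 label)|qQ|].
    * by rewrite L2 Lb1; clear; lia.
    * by rewrite L2 Lb2; clear; lia.
    * have [qz|/(labQ _ qQ)] := eqVneq (sg - 1, sg + d%:R - 2%:R) z0.
        case: z0P => [z1|[]]; first by rewrite -z1 -qz eqxx in m0.
        by rewrite -qz L2; move: d0; clear; lia.
      by rewrite L2; clear; lia.
    * move=> /in_block-/(_ dn) [_ []]; rewrite L2; [by clear; lia..|].
      by case=> /= e; rewrite e eqxx in m2.
  + apply/negP => /inQ3[/(congr1 label)|/(congr1 label)|qQ|].
    * by rewrite L3 Lb1; clear; lia.
    * by rewrite L3 Lb2; clear; lia.
    * have [qz|/(labQ _ qQ)] := eqVneq (sg + 1, sg + d%:R - 1) z0.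
        case: z0P => [z1|[]]; first by rewrite -z1 -qz eqxx in p0.
        by rewrite -qz L3; move: d0; clear; lia.
      by rewrite L3; clear; lia.
    * move=> /in_block-/(_ dn) [_ []]; rewrite L3; [by clear; lia..|].
      by case=> /= e; rewrite e eqxx in p2.
- move=> q fq qm qp; rewrite -keepQ //.
  have qa1 : q != a1 by apply: contra qm => /eqP ->.
  have qb1 : q != b1 by apply: contra qm => /eqP ->.
  have qa2 : q != a2.
    by apply/eqP => /(congr1 label); move: fq df; rewrite La2; clear; lia.
  have qb2 : q != b2.
    apply: contra qp => /eqP qb; have fd : f = (d + 4)%N.
      by move: fq df; rewrite qb Lb2; clear; lia.
    by rewrite qb fd.
  have qB : q \notin block d.
    by apply/negP => /BL; move: fq df; clear; lia.
  rewrite in_setU1 in_setD1 in_setU1 in_setD1 in_setU.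
  by rewrite (negPf qb2) (negPf qb1) qa1 qa2 (negPf qB) orbF.
Qed.

Lemma chain_run f sg (z0 : Z * Z) E1 E2 Q0 (k t : nat) Q :
  sg + sg = 0 -> sg - 1 != 0 -> sg - 1 != 2%:R -> sg + 1 != 0 ->
  sg + 1 != 2%:R -> (z0.1 = 0 \/ label z0 = 0%N /\ z0.1 <> 2%:R) ->
  (f + 4 <= n)%N -> (4 * t <= f)%N ->
  chain f sg z0 E1 E2 Q0 k (4 * t) Q ->
  exists Q', chain f sg z0 E1 E2 Q0 (k + t.*2) 0 Q'.
Proof.
move=> sg2 m0 m2 p0 p2 z0P fn; elim: t k Q => [|t IHt] k Q tf chQ.
  by exists Q; rewrite muln0 in chQ; rewrite addn0.
rewrite mulnS addnC in chQ tf.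
have [Q1 chQ1] := chain_step sg2 m0 m2 p0 p2 z0P fn tf chQ.
have [|Q' chQ'] := IHt _ _ _ chQ1; first by lia.
by exists Q'; rewrite doubleS -add2n addnA.
Qed.

(** The strand misses [h] and [f] and has [0] and [y] in surplus. The [t] blocks carry the missing
    symbol from [f] down to [0], where it cancels; straight diagonals from label [b] on add nothing.
    There remains a surplus at [y] against a lack of [h], harmless if [y = h] and otherwise repaired
    by switching an intercalate. *)
Lemma plexes_of_strand f t sg (z0 : Z * Z) (y : Z) (nu : Z -> Z * Z) :
  f = (4 * t)%N -> (f + 4 <= n)%N ->
  sg + sg = 0 -> sg - 1 != 0 -> sg - 1 != 2%:R -> sg + 1 != 0 ->
  sg + 1 != 2%:R -> (z0.1 = 0 \/ label z0 = 0%N /\ z0.1 <> 2%:R) ->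
  (label z0 <= f + 3)%N ->
  injective (fun i => act (nu i)) -> injective (fun i => (nu i).2) ->
  (forall s, \sum_i (sym (nu i) == s) + delta h%:R s + delta f%:R s =
             1 + delta 0 s + delta y s)%N ->
  (forall i, nu i != z0 -> f <= label (nu i) <= f + 3)%N ->
  let Q0 := [set nu i | i : Z] in
  ((0 < f)%N -> [/\ (sg - 1, sg + f%:R - 1) \in Q0,
    (sg - 1, sg + f%:R - 2%:R) \notin Q0 &
    (sg + 1, sg + f%:R - 1) \notin Q0]) ->
  forall j b, (f + 4 <= b)%N -> (b + j.*2 <= n)%N ->
  exists Q, [/\ uniform act (t + j).*2.+1 Q, uniform snd (t + j).*2.+1 Q,
    forall s, (fiber_count sym Q s + delta h%:R s =
               (t + j).*2.+1 + delta y s)%N &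
    forall q, (f <= label q < b)%N -> q.1 != sg - 1 ->
      q != (sg + 1, sg + f%:R - 1) -> (q \in Q) = (q \in Q0)].
Proof.
move=> ft fn sg2 m0 m2 p0 p2 z0P z0f actI sndI symE labE Q0 corner j b bf bn.
have nuI : injective nu by move=> i1 i2 e; apply: sndI; rewrite e.
have ch : chain f sg z0 (delta h%:R) (fun s => delta 0 s + delta y s)%N Q0
    1 (4 * t) Q0.
  split.
  - by move=> z; rewrite fiber_count_imset // sum_pred1_inj.
  - by move=> z; rewrite fiber_count_imset // sum_pred1_inj.
  - move=> s; rewrite fiber_count_imset // -ft addnA -symE.
    by rewrite addnAC.
  - by move=> _ /imsetP[i _ ->] /labE; rewrite -ft.
  - by rewrite -ft.
  - by [].
have [|Q1 [actQ sndQ symQ labQ _ keepQ]] :=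
  chain_run sg2 m0 m2 p0 p2 z0P fn _ ch; first by rewrite ft.
have [||||Q [actQ' sndQ' symQ' Q'Q]] :=
  @extend_by_diagonals (fun s => delta 0 s + delta h%:R s)%N
    (fun s => delta 0 s + delta y s)%N j b _ Q1 actQ sndQ.
- by move=> s; rewrite addnA; apply: symQ.
- move=> q qQ; have [->|qz] := eqVneq q z0; first by lia.
  by have := labQ q qQ qz; lia.
- by lia.
- by [].
have kE : ((t + j).*2.+1 = 1 + t.*2 + j.*2)%N by rewrite doubleD; lia.
exists Q; rewrite kE; split=> //.
- by move=> s; move: (symQ' s); lia.
- move=> q /andP[fq qb] qm qp; rewrite Q'Q // keepQ //.
Qed.

(** * The latin squares and the passage from encoded cells to plexes *)

Lemma actK q : act (act q, q.2) = q.1.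
Proof. by rewrite /act /=; case: (oddZ q.2) => //; rewrite /rowswap tpermK. Qed.

Definition to_cell q : Z * Z := (act q, q.2).

Lemma to_cellK : involutive to_cell.
Proof. by move=> [r c]; rewrite /to_cell /= actK. Qed.

Lemma kplex_of_uniform (L : Z -> Z -> Z) k Q :
  uniform act k Q -> uniform snd k Q ->
  uniform (fun q => L (act q) q.2) k Q -> has_kplex L k.
Proof.
move=> actQ sndQ LQ; exists [set to_cell q | q in Q].
have cntE (phi : Z * Z -> Z) z :
    #|[set u in [set to_cell q | q in Q] | phi u == z]| =
    fiber_count (phi \o to_cell) Q z.
  rewrite -sum1_card /fiber_count.
  rewrite -(big_imset (fun u => (phi u == z : nat))) /=; last first.
    by move=> q1 q2 _ _; apply: (inv_inj to_cellK).
  rewrite [RHS]big_mkcond [LHS]big_mkcond /=; apply: eq_bigr => u _.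
  by rewrite inE; case: (u \in _) => //=; case: (phi u == z).
split=> [|r|c|s]; last 3 first.
- by rewrite cntE -(actQ r).
- by rewrite cntE -(sndQ c).
- by rewrite (cntE (fun u => L u.1 u.2)) -(LQ s).
rewrite card_imset; last exact: (inv_inj to_cellK).
rewrite -sum1_card (partition_big snd xpredT) //=.
rewrite (eq_bigr (fun=> k)) ?sum_nat_const ?card_ord 1?mulnC // => c _.
rewrite -(sndQ c) /fiber_count [RHS]big_mkcond [LHS]big_mkcond /=.
by apply: eq_bigr => u _; case: (u \in Q) => //=; case: (u.2 == c).
Qed.

(* The intercalate in rows [r1], [r2] and columns [c1], [c2] is switched; taking
   [r1 = r2] leaves [base_square] unchanged. *)
Definition twisted_square (r1 r2 c1 c2 : Z) r c :=
  if (c == c1) || (c == c2) then base_square (tperm r1 r2 r) c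
  else base_square r c.

(** [act] preserves the parity of the row, so equal symbols force columns of equal parity; for
    these, [act] gives the same value. *)
Lemma base_square_row_inj r : injective (base_square r).
Proof.
move=> c1 c2; rewrite /base_square => e; have := congr1 oddZ e.
have oddA c : oddZ (act (r, c)) = oddZ r.
  by rewrite /act /=; case: ifP => _ //; rewrite oddZ_rowswap.
rewrite !oddZD !oddA => /addIb oc; move: e; rewrite /act /= oc.
by move/addIr.
Qed.

Lemma base_square_col_inj c : injective (base_square^~ c).
Proof.
move=> r1 r2; rewrite /base_square => /addrI; rewrite /act /=.
by case: (oddZ c) => // /perm_inj.
Qed.

(** The hypotheses say that the four cells form an intercalate. Exchanging its rows inside two
    columns is then the same as exchanging its columns inside two rows: the first view handles
    columns, the second ([rowE]) handles rows. *)
Lemma twisted_square_latin r1 r2 c1 c2 :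
  base_square r1 c1 = base_square r2 c2 ->
  base_square r1 c2 = base_square r2 c1 ->
  latin_square (twisted_square r1 r2 c1 c2).
Proof.
move=> e1 e2; split=> [r|c]; apply: injF_bij; last first.
  move=> x y; rewrite /twisted_square; case: ifP => _.
    by move/base_square_col_inj/perm_inj.
  exact: base_square_col_inj.
have rowE c : twisted_square r1 r2 c1 c2 r c = base_square r
    (if (r == r1) || (r == r2) then tperm c1 c2 c else c).
  rewrite /twisted_square; case: (tpermP c1 c2 c) => [->|->|/eqP n1 /eqP n2].
  - rewrite eqxx /=; case: tpermP => [->|->|/eqP m1 /eqP m2].
    + by rewrite eqxx /= e2.
    + by rewrite eqxx orbT /= e1.
    + by rewrite (negPf m1) (negPf m2).
  - rewrite eqxx orbT; case: tpermP => [->|->|/eqP m1 /eqP m2].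
    + by rewrite eqxx /= e1.
    + by rewrite eqxx orbT /= e2.
    + by rewrite (negPf m1) (negPf m2).
  - by rewrite (negPf n1) (negPf n2) if_same.
move=> x y; rewrite !rowE => /base_square_row_inj.
by case: ifP => // _ /perm_inj.
Qed.

(** No cell of [Q] other than [x0] lies in the intercalate, so the switch can change only the symbol
    of [x0], and this change must repair the defect of [sym]. *)
Lemma uniform_twisted r1 r2 c1 c2 k Q (x0 : Z * Z) :
  x0 \in Q ->
  (forall q, q \in Q -> q != x0 ->
     ~~ [&& (q.2 == c1) || (q.2 == c2) & (act q == r1) || (act q == r2)]) ->
  (forall s, fiber_count sym Q s +
     delta (twisted_square r1 r2 c1 c2 (act x0) x0.2) s =
     k + delta (sym x0) s)%N ->
  uniform (fun q => twisted_square r1 r2 c1 c2 (act q) q.2) k Q.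
Proof.
move=> x0Q out symQ s.
have symE q : base_square (act q) q.2 = sym q.
  by rewrite /base_square actK addrC.
have outE q : q \in Q -> q != x0 ->
    sym q = twisted_square r1 r2 c1 c2 (act q) q.2.
  move=> qQ qx; rewrite /twisted_square; have := out q qQ qx.
  case: ifP => _; last by rewrite symE.
  rewrite andTb negb_or => /andP[a1 a2].
  by rewrite tpermD 1?eq_sym // symE.
have e := fiber_count_change1 s x0Q outE; have := symQ s; rewrite /delta.
by move=> e'; apply/eqP; rewrite -(eqn_add2r (sym x0 == s)) e e'.
Qed.

(** * The lower bound on odd plexes *)

Lemma sum_Zn : \sum_(z : Z) z = h%:R.
Proof.
have -> : \sum_(z : Z) z = (\sum_(i < n) i)%:R.
  by rewrite natr_sum; apply: eq_bigr => i _; rewrite natr_Zp.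
(* The triangular number is [h * (2 * h - 1)], rewritten to expose a multiple of [n]. *)
have -> : (\sum_(i < n) i = h + (h - 1) * n)%N.
  rewrite -(big_mkord xpredT id) bin2_sum bin2 nh -doubleMl doubleK.
  by case: h h_gt1 => // h' _; rewrite -muln2; nia.
by rewrite natrD natrM natr_order mulr0 addr0.
Qed.

Lemma sum_kplex (phi : Z * Z -> Z) k (P : {set Z * Z}) :
  (forall z, #|[set q in P | phi q == z]| = k) ->
  \sum_(q in P) phi q = k%:R * h%:R.
Proof.
move=> cnt; rewrite -sum_Zn mulr_sumr (partition_big phi xpredT) //=.
apply: eq_bigr => z _; rewrite (eq_bigr (fun=> z)); last by move=> q /andP[_ /eqP].
rewrite sumr_const -(cnt z) mulr_natl; congr (_ *+ _).
by apply: eq_card => q; rewrite !inE.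
Qed.

Lemma odd_mul_half k : odd k -> k%:R * h%:R = h%:R :> Z.
Proof.
move=> ok; rewrite -[k]odd_double_half ok -muln2 natrD natrM mulrDl mul1r.
rewrite -mulrA -natrM; have -> : (2 * h = n)%N by rewrite nh mul2n.
by rewrite natr_order mulr0 addr0.
Qed.

(** One row contributes at most 2 for each of its [k] cells, and one further unit can come from
    [x0]. *)
Lemma sum_row_excess (P : {set Z * Z}) k (d : Z * Z -> nat) r0 (x0 : Z * Z) :
  (forall r, #|[set q in P | q.1 == r]| = k) ->
  (forall q, d q <= 2 * (q.1 == r0) + (q == x0))%N ->
  (\sum_(q in P) d q <= k.*2.+1)%N.
Proof.
move=> rowP dP; apply: (@leq_trans (\sum_(q in P) (2 * (q.1 == r0) + (q == x0))))%N.
  by apply: leq_sum.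
rewrite big_split /= -big_distrr /=.
have -> : (\sum_(q in P) (q.1 == r0) = k)%N.
  rewrite -(rowP r0) -sum1_card [LHS]big_mkcond [RHS]big_mkcond /=.
  by apply: eq_bigr => q _; rewrite inE; case: (q \in P); case: (q.1 == r0).
have total : (\sum_(q : Z * Z) (q == x0) = 1)%N.
  by rewrite (bigD1 x0) // eqxx big1 => [|q /negPf -> //].
have : (\sum_(q in P) (q == x0) <= 1)%N.
  rewrite -total [X in (X <= _)%N]big_mkcond /=.
  by apply: leq_sum => q _; case: ifP.
by rewrite -[k.*2.+1]addn1 -mul2n leq_add2l.
Qed.

(** Here [a] and [b] are the positive and negative parts of symbol minus row minus column. For odd
    [k] the symbols, the rows and the columns of the plex each sum to [h], so [h + sum b = sum a]
    modulo [n]. If [2k + 1 < h], both sides are below [n] and the equality holds in the naturals,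
    although [sum a < h]. *)
Lemma kplex_lower_bound (L : Z -> Z -> Z) k (P : {set Z * Z}) (r0 r1 : Z)
    (x0 x1 : Z * Z) :
  (forall q, exists a b : nat, [/\ L q.1 q.2 + b%:R = q.1 + q.2 + a%:R,
     (a <= 2 * (q.1 == r0) + (q == x0))%N &
     (b <= 2 * (q.1 == r1) + (q == x1))%N]) ->
  odd k -> is_kplex L k P -> (h <= k.*2.+1)%N.
Proof.
move=> excess ok [_ rowP colP symP]; rewrite leqNgt; apply/negP => kh.
have [d dP] := fin_all_exists (fun q => excess q).
have [e eP] := fin_all_exists dP.
have dle := sum_row_excess rowP (fun q => let: And3 _ H _ := eP q in H).
have ele := sum_row_excess rowP (fun q => let: And3 _ _ H := eP q in H).
have E : \sum_(q in P) (L q.1 q.2 + (e q)%:R) =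
         \sum_(q in P) (q.1 + q.2 + (d q)%:R).
  by apply: eq_bigr => q _; case: (eP q).
move: E; rewrite !big_split /= -!natr_sum.
rewrite (sum_kplex symP) (sum_kplex rowP) (sum_kplex colP) odd_mul_half //.
rewrite half_half add0r => /eqP; rewrite -natrD.
move: (\sum_(q in P) d q)%N (\sum_(q in P) e q)%N dle ele => a b ale ble.
by rewrite natr_eqE; move: ale ble kh; rewrite ?nh; clear; lia.
Qed.

Lemma base_square_even r c : ~~ oddZ c -> base_square r c = c + rowswap r.
Proof. by move=> /negPf oc; rewrite /base_square /act /= oc. Qed.

Lemma base_square_odd r c : oddZ c -> base_square r c = c + r.
Proof. by move=> oc; rewrite /base_square /act /= oc. Qed.

Lemma excess_base q : exists a b : nat,
  [/\ base_square q.1 q.2 + b%:R = q.1 + q.2 + a%:R,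
      (a <= 2 * (q.1 == 0)%R)%N & (b <= 2 * (q.1 == 2%:R)%R)%N].
Proof.
case: q => r c /=; case: (boolP (oddZ c)) => oc.
  by exists 0%N, 0%N; split=> //; rewrite base_square_odd //; ring.
rewrite base_square_even // /rowswap; case: tpermP => [->|->|/eqP n0 /eqP n2].
- by exists 2%N, 0%N; rewrite eqxx; split=> //; ring.
- by exists 0%N, 2%N; rewrite eqxx; split=> //; ring.
- by exists 0%N, 0%N; split=> //; ring.
Qed.

Lemma ord012_neq :
  [/\ (0 : Z) != 1, (0 : Z) != 2%:R & (1 : Z) != 2%:R].
Proof.
split; first by rewrite eq_sym oner_eq0.
  by rewrite eq_sym two_neq0.
by rewrite (@natr_eqE 1 2) //; lia.
Qed.

Lemma rowswap1 : rowswap 1 = 1.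
Proof.
by have [n01 _ n12] := ord012_neq; rewrite rowswap_id // eq_sym.
Qed.

Lemma excess_weaken q (x0 x1 : Z * Z) :
  (exists a b : nat, [/\ base_square q.1 q.2 + b%:R = q.1 + q.2 + a%:R,
      (a <= 2 * (q.1 == 0)%R)%N & (b <= 2 * (q.1 == 2%:R)%R)%N]) ->
  exists a b : nat, [/\ base_square q.1 q.2 + b%:R = q.1 + q.2 + a%:R,
      (a <= 2 * (q.1 == 0)%R + (q == x0))%N &
      (b <= 2 * (q.1 == 2%:R)%R + (q == x1))%N].
Proof.
move=> [a [b [e ale ble]]]; exists a, b; split=> //.
  exact: leq_trans ale (leq_addr _ _).
exact: leq_trans ble (leq_addr _ _).
Qed.

(** In row 2 both switched cells have deficit 1, within the allowed 2; the new deviations are in row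
    1, namely [+1] at column [c] and [-1] at column [c + 1]. *)
Lemma excess_twisted12 (c : Z) : oddZ c -> forall q, exists a b : nat,
  [/\ twisted_square 1 2%:R c (c + 1) q.1 q.2 + b%:R = q.1 + q.2 + a%:R,
      (a <= 2 * (q.1 == 0)%R + (q == (1, c)%R))%N &
      (b <= 2 * (q.1 == 2%:R)%R + (q == (1, c + 1)%R))%N].
Proof.
move=> oc [r x]; have [n01 n02 n12] := ord012_neq; rewrite /twisted_square /=.
have oc1 : ~~ oddZ (c + 1) by rewrite oddZD (@oddZ_nat 1) oc.
case: ifP => [/orP[]/eqP -> | _]; last exact: (excess_weaken _ _ (excess_base (r, x))).
- case: tpermP => [->|->|/eqP r1 /eqP r2].
  + exists 1%N, 0%N; rewrite eqxx addn1 base_square_odd //.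
    by split=> //; ring.
  + exists 0%N, 1%N; rewrite eqxx base_square_odd //.
    by split=> //; ring.
  + exact: (excess_weaken _ _ (excess_base (r, c))).
- case: tpermP => [->|->|/eqP r1 /eqP r2].
  + exists 0%N, 1%N; rewrite eqxx addn1 base_square_even // /rowswap tpermR.
    by split=> //; ring.
  + exists 0%N, 1%N; rewrite eqxx base_square_even // rowswap1.
    by split=> //; ring.
  + exact: (excess_weaken _ _ (excess_base (r, c + 1))).
Qed.

(** In row 0 both switched cells have excess 1, within the allowed 2; row 1 gets [+1] at column [c]
    and [-1] at column [c + 1]. *)
Lemma excess_twisted01 (c : Z) : ~~ oddZ c -> forall q, exists a b : nat,
  [/\ twisted_square 0 1 c (c + 1) q.1 q.2 + b%:R = q.1 + q.2 + a%:R,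
      (a <= 2 * (q.1 == 0)%R + (q == (1, c)%R))%N &
      (b <= 2 * (q.1 == 2%:R)%R + (q == (1, c + 1)%R))%N].
Proof.
move=> oc [r x]; have [n01 n02 n12] := ord012_neq; rewrite /twisted_square /=.
have oc1 : oddZ (c + 1) by rewrite oddZD (@oddZ_nat 1) (negPf oc).
case: ifP => [/orP[]/eqP -> | _]; last exact: (excess_weaken _ _ (excess_base (r, x))).
- case: tpermP => [->|->|/eqP r1 /eqP r2].
  + exists 1%N, 0%N; rewrite eqxx base_square_even // rowswap1.
    by split=> //; ring.
  + exists 1%N, 0%N; rewrite eqxx addn1 base_square_even // /rowswap tpermL.
    by split=> //; ring.
  + exact: (excess_weaken _ _ (excess_base (r, c))).
- case: tpermP => [->|->|/eqP r1 /eqP r2].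
  + exists 1%N, 0%N; rewrite eqxx base_square_odd //.
    by split=> //; ring.
  + exists 0%N, 1%N; rewrite eqxx addn1 base_square_odd //.
    by split=> //; ring.
  + exact: (excess_weaken _ _ (excess_base (r, c + 1))).
Qed.

Lemma excess_untwisted q : exists a b : nat,
  [/\ twisted_square 0 0 0 0 q.1 q.2 + b%:R = q.1 + q.2 + a%:R,
      (a <= 2 * (q.1 == 0)%R + (q == (0, 0)%R))%N &
      (b <= 2 * (q.1 == 2%:R)%R + (q == (0, 0)%R))%N].
Proof.
by rewrite /twisted_square tperm1 perm1 if_same; exact: excess_weaken (excess_base q).
Qed.

(** Since [n] is even, complementation preserves odd [k]. It turns the lower bound into the upper
    one, and existence up to [h] into existence above [h]. The condition [h <= 2k + 1] amounts to
    [n %/ 4 <= k]. *)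
Lemma odd_plex_range (L : Z -> Z -> Z) :
  latin_square L ->
  (forall k P, odd k -> is_kplex L k P -> (h <= k.*2.+1)%N) ->
  (forall k, odd k -> (n <= 4 * k + 2)%N -> (k <= h)%N -> has_kplex L k) ->
  forall k, odd k ->
    (has_kplex L k <-> (n %/ 4 <= k /\ k <= (3 * n + 3) %/ 4)%N).
Proof.
move=> latinL lower ex k ok; have on : ~~ odd n by rewrite nh odd_double.
split=> [[P plexP]|[kl ku]].
  have kn : (k <= n)%N by apply: kplex_le plexP.
  have := lower _ _ ok plexP.
  have := lower (n - k)%N _ _ (kplex_compl latinL plexP).
  rewrite oddB // ok (negPf on) => /(_ isT).
  by move: nh; rewrite -muln2; lia.
have [kh|hk] := leqP k h.
  by apply: ex => //; move: nh; rewrite -muln2; lia.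
have [||| P plexP] := ex (n - k)%N.
- by rewrite oddB ?ok ?(negPf on) //; lia.
- by move: nh; rewrite -muln2; lia.
- by move: nh; rewrite -muln2; lia.
exists (~: P); have -> : (k = n - (n - k))%N by lia.
exact: kplex_compl.
Qed.

(** * Near transversals *)

(* Rows [A + i] with [i < m] lie on the diagonal [g + 1], those with [i > m] on
   the diagonal [g], and row [A + m] takes the only column left over.  For
   [m = h] or [m = h - 1] all symbols are distinct except for one. *)
Definition cyc (m i : nat) : nat :=
  if (i < m)%N then i.+1 else if i == m then 0%N else i.

Lemma cyc_inj m : injective (cyc m).
Proof.
move=> i j; rewrite /cyc; case: (ltngtP i m) => im; case: (ltngtP j m) => jm; move: im jm; clear; lia.
Qed.

Lemma cyc_lt m i : (m < n)%N -> (i < n)%N -> (cyc m i < n)%N.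
Proof. by rewrite /cyc; case: (ltngtP i m); clear; lia. Qed.

Lemma natr_eq_lt2 (a x : nat) : (a < n + n)%N -> (x < n)%N ->
  a%:R = x%:R :> Z -> a = x \/ a = (x + n)%N.
Proof.
move=> an xn; have [nale|aln] := leqP n a; last first.
  by move/eqP; rewrite natr_eqE // => /eqP; left.
rewrite (@natr_wrap a (a - n)); last by lia.
by move/eqP; rewrite natr_eqE ?[(a - n < n)%N]/(_); lia.
Qed.

Definition strand (A g m : nat) (i : Z) : Z * Z :=
  ((A + i)%:R, (A + g + cyc m i)%:R).

Lemma strand_snd_inj A g m : (m < n)%N -> injective (fun i => (strand A g m i).2).
Proof.
move=> mn i j /=; rewrite !(natrD _ (A + g)) => /addrI /eqP.
by rewrite natr_eqE ?cyc_lt ?ltn_ord // => /eqP /cyc_inj /ord_inj.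
Qed.

Lemma strand_fst_inj A g m : injective (fun i => (strand A g m i).1).
Proof. by move=> i j /=; rewrite !natrD !natr_Zp => /addrI. Qed.

(** The map sending [i] to [2A + g + 2i + [i < h]] is a bijection and gives the symbols of all rows
    but [A + m], since [i < m] and [i < h] agree for [i] different from [m]. Row [A + m] has symbol
    [2A + g + m] instead of its value under this map. *)
Lemma sum_sym_strand A g m s : (m = h \/ m = (h - 1)%N) ->
  (\sum_i (sym (strand A g m i) == s) +
   delta (A + A + g + m + m + (m < h))%:R s =
   1 + delta (A + A + g + m)%:R s)%N.
Proof.
move=> mh; have mn : (m < n)%N by case: mh => ->; move: nh h_gt1; clear; lia.
pose C : Z := (A + A + g)%:R.
have FI : injective (fun i : Z => C + (i + i + (i < h)%N%:R)).
  by move=> i j /addrI; exact: (double_offset_inj lt_half_alt).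
have S1 := sum_pred1_inj s FI.
pose im : Z := m%:R; have imE : nat_of_ord im = m by exact: natr_small.
rewrite (bigD1 im) //= in S1; rewrite (bigD1 im) //= -S1.
have symm : sym (strand A g m im) = (A + A + g + m)%:R.
  by rewrite /sym /= imE /cyc ltnn eqxx !natrD; ring.
have -> : C + (im + im + (im < h)%N%:R) = (A + A + g + m + m + (m < h))%:R.
  by rewrite imE /C /im !natrD; ring.
rewrite symm /delta.
have -> : (\sum_(i : Z | i != im) (sym (strand A g m i) == s) =
  \sum_(i : Z | i != im) ((C + (i + i + (i < h)%N%:R))%R == s))%N.
  apply: eq_bigr => i ne; have {}ne : nat_of_ord i != m.
    by rewrite -imE; apply: contra ne => /eqP /ord_inj ->.
  congr ((_ == s) : nat); rewrite /sym /= /C.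
  have -> : cyc m i = (i + (i < h)%N)%N.
    rewrite /cyc; case: ltngtP ne => // im' _; case: mh im' => -> ; case: ltnP => //; clear; lia.
  by rewrite !natrD !natr_Zp; ring.
by rewrite addnC addnA addnAC.
Qed.

Definition bent_strand A g m i : Z * Z :=
  (if (strand A g m i).1 == 0 then 2%:R else (strand A g m i).1,
   (strand A g m i).2).

(** The cell with [rho = 0] lies in the even column [f], so bending puts it in actual row 0; the
    original cell with [rho = 2] is in an odd column and stays in row 2. Thus every row is still met
    once. Bending changes one symbol [f] into [f + 2]. The choice [g = m - 2] gives the exceptional
    row [A + m] label 0 and the other unbent cells labels [m] and [m + 1]. Columns are exchanged
    between rows -1 and 1, that is, [sg = 0]. *)
Lemma bent_strand_plexes f t A m j b :
  f = (4 * t)%N -> (f + 4 <= n)%N -> (m = h \/ m = (h - 1)%N) ->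
  (A <= n)%N -> (f <= m - 1 <= f + 1)%N -> (1 < m)%N ->
  (forall i : Z, (A + i)%:R = 0 :> Z ->
     (A + (m - 2) + cyc m i)%:R = f%:R :> Z) ->
  (forall i : Z, (A + i)%:R = 2%:R :> Z ->
     odd (A + (m - 2) + cyc m i)) ->
  (A + A + (m - 2) + m + m + (m < h))%:R = h%:R :> Z ->
  (A + A + (m - 2) + m)%:R = 0 :> Z ->
  (A + m)%:R != 0 :> Z -> (A + m)%:R != 2%:R :> Z ->
  ((0 < f)%N -> forall i : Z, (A + i)%:R = - 1 :> Z ->
     (A + (m - 2) + cyc m i)%:R = f%:R - 1 :> Z) ->
  (f + 4 <= b)%N -> (b + j.*2 <= n)%N ->
  exists Q, [/\ uniform act (t + j).*2.+1 Q, uniform snd (t + j).*2.+1 Q,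
    forall s, (fiber_count sym Q s + delta h%:R s =
               (t + j).*2.+1 + delta (f + 2)%:R s)%N &
    forall q, (f <= label q < b)%N -> q.1 != - 1 -> q != (1, f%:R - 1) ->
      (q \in Q) = (q \in [set bent_strand A (m - 2) m i | i : Z])].
Proof.
move=> ft fn mh An fm m1 row0 row2 raw raw0 z00 z02 rowm bf bn.
have mn : (m < n)%N by case: mh => ->; move: nh h_gt1; clear; lia.
have oddf : ~~ oddZ f%:R by rewrite oddZ_nat ft oddM.
have [n01 n02 n12] := ord012_neq.
have m10 : - 1 != 0 :> Z by rewrite oppr_eq0 oner_eq0.
have m12 : - 1 != 2%:R :> Z.
  rewrite -subr_eq0 -opprD oppr_eq0.
  by rewrite (_ : 1 + 2%:R = 3%:R) ?(@natr_eqE 3 0) //; move: nh h_gt1; clear; lia.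
have mE : m%:R = (m - 2)%:R + 2%:R :> Z by rewrite -natrD subnK.
pose nu := bent_strand A (m - 2) m.
pose im : Z := m%:R; have imE : nat_of_ord im = m by exact: natr_small.
have actE i : act (nu i) = (A + i)%:R.
  rewrite /nu /bent_strand /=; case: eqVneq => [r0|r0].
    by rewrite r0 (row0 _ r0) /act /= (negPf oddf) /rowswap tpermR.
  have [r2|r2] := eqVneq ((A + i)%:R : Z) 2%:R; last exact: act_id.
  by rewrite /act /= oddZ_nat (row2 _ r2).
have labE i : i != im -> (f <= label (nu i) <= f + 3)%N.
  move=> ne; have {}ne : nat_of_ord i != m.
    by rewrite -imE; apply: contra ne => /eqP /ord_inj ->.
  rewrite /nu /bent_strand /=; case: eqVneq => [r0|r0].
    rewrite (row0 _ r0) (@labelE _ _ f); first by clear; lia.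
      by rewrite subrK.
    by move: fn; clear; lia.
  rewrite (@labelE _ _ (m + (i < m))%N).
  - by move: fm m1; case: ltnP; clear; lia.
  - rewrite /cyc; case: ltngtP ne => //= _ _; rewrite !natrD mE.
      by rewrite -natr1; ring.
    by ring.
  - by move: fm m1 fn; case: ltnP; clear; lia.
have nuim : nu im = ((A + m)%:R, (A + (m - 2))%:R).
  rewrite /nu /bent_strand /= imE /cyc ltnn eqxx addn0 (negPf z00).
  by [].
have labz : label (nu im) = 0%N.
  rewrite nuim; apply: labelE => //.
  by rewrite !natrD mE; ring.
have i0P : exists i0 : Z, (A + i0)%:R = 0 :> Z.
  by exists (- A%:R); rewrite natrD natr_Zp subrr.
have symE s : (\sum_i (sym (nu i) == s) + delta h%:R s + delta f%:R s =
    1 + delta 0 s + delta (f + 2)%:R s)%N.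
  have [i0 r0] := i0P.
  have := sum_sym_strand A (m - 2) s mh; rewrite raw raw0.
  rewrite (bigD1 i0) //= [in X in _ -> X](bigD1 i0) //=.
  have -> : sym (strand A (m - 2) m i0) = f%:R.
    by rewrite /sym /= r0 (row0 _ r0) add0r.
  have -> : sym (nu i0) = (f + 2)%:R.
    by rewrite /sym /nu /bent_strand /= r0 eqxx (row0 _ r0) natrD addrC.
  have -> : (\sum_(i | i != i0) (sym (nu i) == s) =
             \sum_(i | i != i0) (sym (strand A (m - 2) m i) == s))%N.
    apply: eq_bigr => i ne; congr ((_ == s) : nat).
    rewrite /nu /bent_strand; case: eqP => // e.
    case/eqP: ne; apply: (@strand_fst_inj A (m - 2) m).
    exact: etrans e (esym r0).
  have linear (x a1 a2 a3 a4 : nat) :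
      (a1 + x + a2 = 1 + a3 -> a4 + x + a2 + a1 = 1 + a3 + a4)%N.
    by clear; lia.
  exact: linear.
have actI : injective (fun i => act (nu i)).
  by move=> i1 i2 /=; rewrite !actE => e; apply: (@strand_fst_inj A (m - 2) m).
have sndI : injective (fun i => (nu i).2) by apply: strand_snd_inj.
have corner : (0 < f)%N -> [/\ (0 - 1, 0 + f%:R - 1) \in [set nu i | i : Z],
    (0 - 1, 0 + f%:R - 2%:R) \notin [set nu i | i : Z] &
    (0 + 1, 0 + f%:R - 1) \notin [set nu i | i : Z]].
  move=> f0; rewrite !add0r; have [i1 r1] : exists i1 : Z, (A + i1)%:R = - 1 :> Z.
    by exists (- 1 - A%:R); rewrite natrD natr_Zp addrC subrK.
  have nu1 : nu i1 = (- 1, f%:R - 1).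
    by rewrite /nu /bent_strand /= r1 (negPf m10) rowm.
  split; first by apply/imsetP; exists i1.
    apply/imsetP => -[i _ e]; have i1E : i = i1.
      apply: actI; rewrite nu1 -e [RHS]act_id // [LHS]act_id //.
    move: (congr1 snd e); rewrite i1E nu1 /= => /addrI /oppr_inj /eqP.
    by rewrite eq_sym (@natr_eqE 1 2) //; move: nh h_gt1; clear; lia.
  apply/imsetP => -[i _ e]; have i1E : i = i1 by apply: sndI; rewrite nu1 -e.
  move: (congr1 fst e); rewrite i1E nu1 /= => /eqP.
  rewrite -subr_eq0 opprK (_ : 1 + 1 = 2%:R) //.
  by rewrite (negPf two_neq0).
have [||||||||] := @plexes_of_strand f t 0 (nu im) (f + 2)%:R nu ft fn
   _ _ _ _ _ _ _ actI sndI symE _ corner j b bf bn.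
- by rewrite addr0.
- by rewrite sub0r.
- by rewrite sub0r.
- by rewrite add0r oner_eq0.
- by rewrite add0r.
- by right; split=> //; rewrite nuim; apply/eqP.
- by rewrite labz.
- by move=> i ne; apply: labE; apply: contra ne => /eqP ->.
- move=> Q [actQ sndQ symQ keepQ]; exists Q; split=> //.
  by move=> q lq q1 q2; apply: keepQ; rewrite ?sub0r ?add0r.
Qed.

(** * The four residues of the order modulo 8 *)

Lemma natr_mod_eq (a b j : nat) : a = (b + j * n)%N -> a%:R = b%:R :> Z.
Proof. by move=> ->; rewrite natrD natrM natr_order mulr0 addr0. Qed.

Lemma natr_pred : (n - 1)%:R = - 1 :> Z.
Proof. by apply/eqP; rewrite -subr_eq0 opprK natr1 subn1 /= natr_order. Qed.

(** The congruences are turned into equalities of naturals with explicit multiples of [n], so that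
    each residue class reduces to linear arithmetic. *)
Lemma nat_strand_plexes f t A m j b (j1 j2 : nat) :
  f = (4 * t)%N -> (f + 4 <= n)%N -> (m = h \/ m = h - 1)%N ->
  (0 < A)%N -> (A + 2 <= n)%N -> (f <= m - 1 <= f + 1)%N -> (1 < m)%N ->
  (forall a, A + a = n -> A + (m - 2) + cyc m a = f + n)%N ->
  (forall a, a < n -> A + a = 2 \/ A + a = n + 2 -> odd (A + (m - 2) + cyc m a))%N ->
  (A + A + (m - 2) + m + m + (m < h) = h + j1 * n)%N ->
  (A + A + (m - 2) + m = j2 * n)%N ->
  (A + m = n + 1 \/ 2 < A + m < n)%N ->
  (0 < f -> forall a, A + a = n - 1 -> A + (m - 2) + cyc m a + 1 = f + n)%N ->
  (f + 4 <= b)%N -> (b + j.*2 <= n)%N ->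
  exists Q, [/\ uniform act (t + j).*2.+1 Q, uniform snd (t + j).*2.+1 Q,
    forall s, (fiber_count sym Q s + delta h%:R s =
               (t + j).*2.+1 + delta (f + 2)%:R s)%N &
    forall q, (f <= label q < b)%N -> q.1 != - 1 -> q != (1, f%:R - 1) ->
      (q \in Q) = (q \in [set bent_strand A (m - 2) m i | i : Z])].
Proof.
move=> ft fn mh A0 An fm m1 row0 row2 raw raw0 zrow rowm bf bn.
have An' : (A <= n)%N by move: An; clear; lia.
have n4 : (4 <= n)%N by move: fn; clear; lia.
apply: (bent_strand_plexes ft fn mh An' fm m1) => //.
- move=> i; move: (nat_of_ord i) (ltn_ord i) => a an.
  rewrite -[0]/(0%:R) => /natr_eq_lt2 [||e|e].
  + by move: an An; clear; lia.
  + by [].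
  + by move: e A0; clear; lia.
  + by rewrite row0 // natrD natr_order addr0.
- move=> i; move: (nat_of_ord i) (ltn_ord i) => a an /natr_eq_lt2 [||e|e].
  + by move: an An; clear; lia.
  + by move: n4; clear; lia.
  + by apply: row2 => //; left.
  + by apply: row2 => //; right; rewrite e addnC.
- exact: natr_mod_eq raw.
- by rewrite raw0 natrM natr_order mulr0.
- case: zrow => [->|/andP[z2 zn]].
    by rewrite natrD natr_order add0r oner_eq0.
  by rewrite (@natr_eqE _ 0) //; move: z2; clear; lia.
- case: zrow => [->|/andP[z2 zn]].
    by rewrite natrD natr_order add0r (@natr_eqE 1 2) //; move: n4; clear; lia.
  by rewrite (@natr_eqE _ 2) //; move: z2 zn; clear; lia.
- move=> f0 i; move: (nat_of_ord i) (ltn_ord i) => a an.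
  rewrite -natr_pred => /natr_eq_lt2 [||e|e].
  + by move: an An; clear; lia.
  + by clear; lia.
  + have E := natr_wrap (rowm f0 _ e).
    by rewrite natr_pred -E [in RHS]natrD addrK.
  + by move: e an An; clear; lia.
Qed.

Lemma has_kplex_untwisted k Q :
  uniform act k Q -> uniform snd k Q ->
  (forall s, fiber_count sym Q s + delta h%:R s = k + delta h%:R s)%N ->
  has_kplex (twisted_square 0 0 0 0) k.
Proof.
move=> actQ sndQ symQ; apply: (kplex_of_uniform actQ sndQ) => s.
apply/eqP; rewrite -(eqn_add2r (delta h%:R s)) -symQ; apply/eqP.
congr (_ + _)%N; apply: eq_fiber_count => q _.
by rewrite /twisted_square tperm1 perm1 if_same /base_square actK addrC.
Qed.

Lemma odd_half_index t k : odd k -> (4 * t <= 2 * k + 1)%N ->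
  k = (t + (k./2 - t)).*2.+1.
Proof.
move=> ok tk; have := odd_double_half k; rewrite ok => kE.
rewrite subnKC; first by rewrite -[LHS]kE.
by rewrite -kE in tk; move: tk; clear; lia.
Qed.

(** With [f = 4t] the surplus symbol [f + 2] is exactly the missing [h], so the untwisted square
    suffices. *)
Lemma case_n4mod8 t : h = (4 * t + 2)%N ->
  exists L : Z -> Z -> Z, latin_square L /\
    forall k, odd k ->
    (has_kplex L k <-> (n %/ 4 <= k /\ k <= (3 * n + 3) %/ 4)%N).
Proof.
move=> ht; have latinL : latin_square (twisted_square 0 0 0 0).
  exact: twisted_square_latin.
exists (twisted_square 0 0 0 0); split=> //.
apply: (odd_plex_range latinL).
  by move=> k P; exact: (kplex_lower_bound excess_untwisted).
have nE : n = (8 * t + 4)%N by rewrite nh ht -muln2; clear; lia.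
move=> k ok nk kh; have kE : k = (t + (k./2 - t)).*2.+1.
  by apply: odd_half_index => //; move: nk; rewrite nE; clear; lia.
move: (k./2 - t)%N kE => j kE.
have [|||||||||||||||Q [actQ sndQ symQ _]] :=
  @nat_strand_plexes (4 * t) t 1 h j (4 * t + 4) 1 1; rewrite ?nE ?ht.
- by [].
- by clear; lia.
- by left.
- by [].
- by clear; lia.
- by clear; lia.
- by clear; lia.
- by move=> a; rewrite /cyc; case: (ltngtP a (4 * t + 2)); clear; lia.
- move=> a; rewrite /cyc; case: (ltngtP a (4 * t + 2)); clear; lia.
- by clear; lia.
- by clear; lia.
- by clear; lia.
- by move=> t0 a; rewrite /cyc; case: (ltngtP a (4 * t + 2)); move: t0; clear; lia.
- by [].
- by move: kE kh; rewrite ht -!muln2; clear; lia.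
by rewrite kE; apply: (has_kplex_untwisted actQ sndQ) => s; rewrite symQ ht.
Qed.

Lemma cyc_gt m i : (m < i)%N -> cyc m i = i.
Proof. by rewrite /cyc; case: ltngtP. Qed.

Lemma in_bent_strand A g m a : (a < n)%N ->
  (if (A + a)%:R == 0 :> Z then 2%:R else (A + a)%:R, (A + g + cyc m a)%:R)
  \in [set bent_strand A g m i | i : Z].
Proof.
move=> an; apply/imsetP; exists a%:R => //.
by rewrite /bent_strand /= natr_small.
Qed.

Lemma bent_strand_row A g m a q : (m < n)%N -> (a < n)%N ->
  q \in [set bent_strand A g m i | i : Z] -> q.2 = (A + g + cyc m a)%:R ->
  q.1 = if (A + a)%:R == 0 :> Z then 2%:R else (A + a)%:R.
Proof.
move=> mn an /imsetP[i _ ->] /= /eqP; rewrite !(natrD _ (A + g)).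
rewrite (inj_eq (addrI _)) natr_eqE ?cyc_lt ?ltn_ord //.
by move/eqP/cyc_inj ->.
Qed.

Lemma act_eq q r : act q = r -> q = (act (r, q.2), q.2).
Proof. by move=> <-; rewrite actK; case: q. Qed.

(** The surplus symbol is [4t + 2 = h - 1]. Switching rows 1, 2 in columns [c], [c + 1] changes it
    to [h] at the cell [(1, c)]. *)
Lemma case_n6mod8 t : h = (4 * t + 3)%N ->
  (t = 0%N -> has_kplex (twisted_square 1 2%:R 1 (1 + 1)) 3) ->
  exists L : Z -> Z -> Z, latin_square L /\
    forall k, odd k ->
    (has_kplex L k <-> (n %/ 4 <= k /\ k <= (3 * n + 3) %/ 4)%N).
Proof.
move=> ht small; have nE : n = (8 * t + 6)%N by rewrite nh ht -muln2; clear; lia.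
have [n01 n02 n12] := ord012_neq.
pose c : Z := (4 * t + 1)%:R.
have c1E : c + 1 = (4 * t + 2)%:R by rewrite /c natr1 -addnS.
have oc : oddZ c by rewrite oddZ_nat oddD oddM.
have oc1 : ~~ oddZ (c + 1) by rewrite c1E oddZ_nat oddD oddM.
have latinL : latin_square (twisted_square 1 2%:R c (c + 1)).
  apply: twisted_square_latin.
    by rewrite (base_square_odd _ oc) (base_square_even _ oc1) /rowswap tpermR addr0.
  by rewrite (base_square_odd _ oc) (base_square_even _ oc1) rowswap1; ring.
exists (twisted_square 1 2%:R c (c + 1)); split=> //.
apply: (odd_plex_range latinL).
  by move=> k P; exact: (kplex_lower_bound (excess_twisted12 oc)).
move=> k ok nk kh; have kE : k = (t + (k./2 - t)).*2.+1.
  by apply: odd_half_index => //; move: nk; rewrite nE; clear; lia.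
(* Only for order 6 and [k = 3] is there no room for the diagonals to be added; this plex is
   supplied separately. *)
have [/andP[/eqP t0 /eqP k3]|gen] := boolP ((t == 0%N) && (k == 3)).
  by rewrite k3 /c t0 muln0 add0n; apply: small.
move: (k./2 - t)%N kE => j kE.
have mh : (4 * t + 2 < h)%N by rewrite ht; clear; lia.
(* Taking [b = 4t + 6] leaves labels [4t + 4] and [4t + 5] free: the intercalate cell in actual row
   2 and column [c + 1] is encoded as [(0, c + 1)], with label [4t + 4]. *)
have [|||||||||||||||Q [actQ sndQ symQ keepQ]] :=
  @nat_strand_plexes (4 * t) t 2 (4 * t + 2) j (4 * t + 6) 1 1; rewrite ?nE ?ht.
- by [].
- by clear; lia.
- by right; clear; lia.
- by [].
- by clear; lia.
- by clear; lia.
- by clear; lia.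
- by move=> a; rewrite /cyc; case: (ltngtP a (4 * t + 2)); clear; lia.
- by move=> a; rewrite /cyc; case: (ltngtP a (4 * t + 2)); clear; lia.
- by clear; lia.
- by clear; lia.
- by clear; lia.
- by move=> t0 a; rewrite /cyc; case: (ltngtP a (4 * t + 2)); move: t0; clear; lia.
- by clear; lia.
- by move: kE kh gen ok; rewrite ht -!muln2; clear; lia.
have mn : (4 * t + 2 < n)%N by rewrite nE; clear; lia.
have an1 : (n - 1 < n)%N by rewrite nE; clear; lia.
have row_c q : q \in [set bent_strand 2 (4 * t + 2 - 2) (4 * t + 2) i | i : Z] ->
    q.2 = c -> q.1 = 1.
  move=> qS qc; rewrite (bent_strand_row mn an1 qS).
    have -> : (2 + (n - 1))%:R = 1 :> Z.
      by apply: (@natr_mod_eq _ 1 1); rewrite nE; clear; lia.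
    by rewrite oner_eq0.
  rewrite qc cyc_gt; last by rewrite nE; clear; lia.
  by apply/esym/(@natr_mod_eq _ _ 1); rewrite nE; clear; lia.
have row_c1 q : q \in [set bent_strand 2 (4 * t + 2 - 2) (4 * t + 2) i | i : Z] ->
    q.2 = c + 1 -> q.1 = (4 * t + 4)%:R.
  move=> qS qc; rewrite (bent_strand_row mn mn qS).
    have -> : (2 + (4 * t + 2) = 4 * t + 4)%N by clear; lia.
    have /negPf -> // : (4 * t + 4)%:R != 0 :> Z.
    by rewrite (@natr_eqE _ 0) ?nE //; clear; lia.
  by rewrite qc c1E /cyc ltnn eqxx; congr _%:R; clear; lia.
have m1n : (- 1 : Z) = (8 * t + 5)%:R.
  have predE : (n - 1 = 8 * t + 5)%N by rewrite nE; clear; lia.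
  by rewrite -natr_pred predE.
have keep r x (l : nat) : label (r, x) = l -> (4 * t <= l < 4 * t + 6)%N ->
    r != - 1 -> x != (4 * t)%:R - 1 -> (r, x) \in Q ->
    (r, x) \in [set bent_strand 2 (4 * t + 2 - 2) (4 * t + 2) i | i : Z].
  move=> lE lb r1 x1; rewrite keepQ ?lE //.
  by apply: contra x1 => /eqP[_ ->].
have m1neq (a : nat) : (a < 8 * t + 5)%N -> (a%:R : Z) != - 1.
  move=> al; rewrite m1n natr_eqE ?nE; move: al; clear; lia.
have c_neq : c != (4 * t)%:R - 1.
  rewrite -subr_eq0 /c natrD (_ : _ - _ = 2%:R) ?two_neq0 //; ring.
have c1_neq : c + 1 != (4 * t)%:R - 1.
  rewrite -subr_eq0 c1E natrD (_ : _ - _ = 3%:R); last by ring.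
  by rewrite (@natr_eqE 3 0) // nE; clear; lia.
have x0Q : (1, c) \in Q.
  rewrite keepQ //.
  - have := @in_bent_strand 2 (4 * t + 2 - 2) (4 * t + 2) (n - 1) an1.
    have -> : (2 + (n - 1))%:R = 1 :> Z.
      by apply: (@natr_mod_eq _ 1 1); rewrite nE; clear; lia.
    rewrite (negPf (oner_neq0 _)) cyc_gt; last by rewrite nE; clear; lia.
    have -> // : (2 + (4 * t + 2 - 2) + (n - 1))%:R = c.
    by apply: (@natr_mod_eq _ _ 1); rewrite nE; clear; lia.
  - rewrite (@labelE _ _ (4 * t + 2)); first by clear; lia.
      by rewrite /c !natrD; ring.
    by rewrite nE; clear; lia.
  - by apply: (m1neq 1%N); clear; lia.
rewrite kE; apply: (kplex_of_uniform actQ sndQ).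
apply: (uniform_twisted x0Q).
  have row4 : (4 * t + 4 < n)%N by rewrite nE; clear; lia.
  (* The other three intercalate cells are absent because the strand occupies columns [c] and
     [c + 1] at [rho = 1] and [rho = 4t + 4]. *)
  move=> q qQ qx; apply/negP => /andP[/orP[]/eqP q2 /orP[]/eqP/act_eq qE];
    rewrite q2 /act /= ?oc ?(negPf oc1) ?rowswap1 ?/rowswap ?tpermR in qE.
  - by rewrite qE eqxx in qx.
  - have qS : q \in [set bent_strand 2 (4 * t + 2 - 2) (4 * t + 2) i | i : Z].
      rewrite qE in qQ *; apply: (keep _ _ (4 * t + 1)%N _ _ _ _ qQ) => //.
      + apply: labelE; first by rewrite /c; ring.
        by rewrite nE; clear; lia.
      + by clear; lia.
      + by apply: (m1neq 2%N); clear; lia.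
    by move: (row_c q qS q2) n12; rewrite qE /= => ->; rewrite eqxx.
  - have qS : q \in [set bent_strand 2 (4 * t + 2 - 2) (4 * t + 2) i | i : Z].
      rewrite qE in qQ *; apply: (keep _ _ (4 * t + 3)%N _ _ _ _ qQ) => //.
      + apply: labelE; first by rewrite c1E !natrD; ring.
        by rewrite nE; clear; lia.
      + by clear; lia.
      + by apply: (m1neq 1%N); clear; lia.
    move: (row_c1 q qS q2); rewrite qE /= => /eqP.
    by rewrite (@natr_eqE 1) //; clear; lia.
  - have qS : q \in [set bent_strand 2 (4 * t + 2 - 2) (4 * t + 2) i | i : Z].
      rewrite qE in qQ *; apply: (keep _ _ (4 * t + 4)%N _ _ _ _ qQ) => //.
      + apply: labelE; first by rewrite c1E !natrD; ring.
        by rewrite nE; clear; lia.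
      + by clear; lia.
      + by apply: (m1neq 0%N); clear; lia.
    move: (row_c1 q qS q2); rewrite qE /= => /eqP.
    by rewrite (@natr_eqE 0) //; clear; lia.
move=> s; have := symQ s; rewrite /act /= oc /twisted_square eqxx /= tpermL.
have -> : base_square 2%:R c = h%:R.
  by rewrite (base_square_odd _ oc) -natrD ht; congr _%:R; clear; lia.
have -> : sym (1, c) = (4 * t + 2)%:R by rewrite -c1E /sym addrC.
by [].
Qed.

(** The surplus symbol is [4t + 2 = h + 1], carried by the bent cell [(2, c)], which lies in actual
    row 0. Switching rows 0, 1 in columns [c], [c + 1] lowers it to [h]. *)
Lemma case_n2mod8 t : (0 < t)%N -> h = (4 * t + 1)%N ->
  exists L : Z -> Z -> Z, latin_square L /\
    forall k, odd k ->
    (has_kplex L k <-> (n %/ 4 <= k /\ k <= (3 * n + 3) %/ 4)%N).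
Proof.
move=> t0 ht; have nE : n = (8 * t + 2)%N by rewrite nh ht -muln2; move: t0; clear; lia.
have [n01 n02 n12] := ord012_neq.
pose c : Z := (4 * t)%:R.
have c1E : c + 1 = (4 * t + 1)%:R by rewrite /c natr1 addn1.
have oc : ~~ oddZ c by rewrite oddZ_nat oddM.
have oc1 : oddZ (c + 1) by rewrite c1E oddZ_nat oddD oddM.
have latinL : latin_square (twisted_square 0 1 c (c + 1)).
  apply: twisted_square_latin.
    rewrite (base_square_odd _ oc1) (base_square_even _ oc) /rowswap tpermL.
    by ring.
  by rewrite (base_square_odd _ oc1) (base_square_even _ oc) rowswap1 addr0.
exists (twisted_square 0 1 c (c + 1)); split=> //.
apply: (odd_plex_range latinL).
  by move=> k P; exact: (kplex_lower_bound (excess_twisted01 oc)).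
move=> k ok nk kh; have kE : k = (t + (k./2 - t)).*2.+1.
  by apply: odd_half_index => //; move: nk; rewrite nE; move: t0; clear; lia.
move: (k./2 - t)%N kE => j kE.
have [|||||||||||||||Q [actQ sndQ symQ keepQ]] :=
  @nat_strand_plexes (4 * t) t (4 * t + 2) (4 * t + 1) j (4 * t + 4) 2 2;
  rewrite ?nE ?ht.
- by [].
- by move: t0; clear; lia.
- by left.
- by move: t0; clear; lia.
- by move: t0; clear; lia.
- by move: t0; clear; lia.
- by move: t0; clear; lia.
- by move=> a; rewrite /cyc; case: (ltngtP a (4 * t + 1)); move: t0; clear; lia.
- by move=> a; rewrite /cyc; case: (ltngtP a (4 * t + 1)); move: t0; clear; lia.
- by move: t0; clear; lia.
- by move: t0; clear; lia.
- by move: t0; clear; lia.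
- by move=> _ a; rewrite /cyc; case: (ltngtP a (4 * t + 1)); move: t0; clear; lia.
- by move: t0; clear; lia.
- by move: kE kh ok; rewrite ht -!muln2; move: t0; clear; lia.
have mn : (4 * t + 1 < n)%N by rewrite nE; move: t0; clear; lia.
have an1 : (4 * t < n)%N by rewrite nE; move: t0; clear; lia.
have an2 : (4 * t + 2 < n)%N by rewrite nE; move: t0; clear; lia.
have cyc1 : cyc (4 * t + 1) (4 * t) = (4 * t + 1)%N.
  by rewrite /cyc addn1 ltnSn.
pose S := [set bent_strand (4 * t + 2) (4 * t + 1 - 2) (4 * t + 1) i | i : Z].
have zero_row : (4 * t + 2 + 4 * t)%:R = 0 :> Z.
  by apply: (@natr_mod_eq _ 0 1); rewrite nE; move: t0; clear; lia.
have c_col : (4 * t + 2 + (4 * t + 1 - 2) + (4 * t + 1))%:R = c.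
  by apply: (@natr_mod_eq _ _ 1); rewrite nE; move: t0; clear; lia.
have row_c q : q \in S -> q.2 = c -> q.1 = 2%:R.
  move=> qS qc; rewrite (bent_strand_row mn an1 qS) ?zero_row ?eqxx //.
  by rewrite qc cyc1 c_col.
have row_c1 q : q \in S -> q.2 = c + 1 -> q.1 = 2%:R.
  move=> qS qc; rewrite (bent_strand_row mn an2 qS).
    have -> : (4 * t + 2 + (4 * t + 2))%:R = 2%:R :> Z.
      by apply: (@natr_mod_eq _ _ 1); rewrite nE; move: t0; clear; lia.
    by rewrite (negPf two_neq0).
  rewrite qc c1E cyc_gt; last by move: t0; clear; lia.
  by apply/esym/(@natr_mod_eq _ _ 1); rewrite nE; move: t0; clear; lia.
have m1n : (- 1 : Z) = (8 * t + 1)%:R.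
  have predE : (n - 1 = 8 * t + 1)%N by rewrite nE; move: t0; clear; lia.
  by rewrite -natr_pred predE.
have keep r x (l : nat) : label (r, x) = l -> (4 * t <= l < 4 * t + 4)%N ->
    r != - 1 -> x != (4 * t)%:R - 1 -> (r, x) \in Q -> (r, x) \in S.
  move=> lE lb r1 x1; rewrite keepQ ?lE //.
  by apply: contra x1 => /eqP[_ ->].
have m1neq (a : nat) : (a < 8 * t + 1)%N -> (a%:R : Z) != - 1.
  move=> al; rewrite m1n natr_eqE ?nE; move: al; move: t0; clear; lia.
have c_neq : c != (4 * t)%:R - 1.
  rewrite -subr_eq0 /c (_ : _ - _ = 1) ?oner_eq0 //; ring.
have c1_neq : c + 1 != (4 * t)%:R - 1.
  rewrite -subr_eq0 /c (_ : _ - _ = 2%:R) ?two_neq0 //; ring.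
have x0Q : (2%:R, c) \in Q.
  rewrite keepQ //.
  - have := @in_bent_strand (4 * t + 2) (4 * t + 1 - 2) (4 * t + 1) _ an1.
    by rewrite zero_row eqxx cyc1 c_col.
  - rewrite (@labelE _ _ (4 * t)); first by move: t0; clear; lia.
      by rewrite /c; ring.
    by rewrite nE; move: t0; clear; lia.
  - by apply: (m1neq 2%N); move: t0; clear; lia.
  - apply/eqP => /(congr1 fst) /= /eqP.
    by rewrite eq_sym (negPf n12).
rewrite kE; apply: (kplex_of_uniform actQ sndQ).
apply: (uniform_twisted x0Q).
  (* In both columns [c] and [c + 1] the strand has [rho = 2], whereas the other three intercalate
     cells have [rho] equal to 0 or 1. *)
  move=> q qQ qx; apply/negP => /andP[/orP[]/eqP q2 /orP[]/eqP/act_eq qE];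
    rewrite q2 /act /= ?oc1 ?(negPf oc) ?rowswap1 ?/rowswap ?tpermL in qE.
  - by rewrite qE eqxx in qx.
  - have qS : q \in S.
      rewrite qE in qQ *; apply: (keep _ _ (4 * t + 1)%N _ _ _ _ qQ) => //.
      + apply: labelE; first by rewrite /c natrD; ring.
        by rewrite nE; move: t0; clear; lia.
      + by move: t0; clear; lia.
      + by apply: (m1neq 1%N); move: t0; clear; lia.
    by have /eqP := row_c q qS q2; rewrite qE /= (negPf n12).
  - have qS : q \in S.
      rewrite qE in qQ *; apply: (keep _ _ (4 * t + 3)%N _ _ _ _ qQ) => //.
      + apply: labelE; first by rewrite c1E !natrD; ring.
        by rewrite nE; move: t0; clear; lia.
      + by move: t0; clear; lia.
      + by apply: (m1neq 0%N); move: t0; clear; lia.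
    by have /eqP := row_c1 q qS q2; rewrite qE /= (negPf n02).
  - have qS : q \in S.
      rewrite qE in qQ *; apply: (keep _ _ (4 * t + 2)%N _ _ _ _ qQ) => //.
      + apply: labelE; first by rewrite c1E !natrD; ring.
        by rewrite nE; move: t0; clear; lia.
      + by move: t0; clear; lia.
      + by apply: (m1neq 1%N); move: t0; clear; lia.
    by have /eqP := row_c1 q qS q2; rewrite qE /= (negPf n12).
move=> s; have := symQ s; rewrite /act /= (negPf oc) /rowswap tpermR.
rewrite /twisted_square eqxx /= tpermL.
have -> : base_square 1 c = h%:R.
  by rewrite (base_square_even _ oc) rowswap1 c1E ht.
have -> : sym (2%:R, c) = (4 * t + 2)%:R by rewrite /sym /= /c natrD addrC.
by [].
Qed.

Lemma case_n0mod8 t : (0 < t)%N -> h = (4 * t)%N ->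
  exists L : Z -> Z -> Z, latin_square L /\
    forall k, odd k ->
    (has_kplex L k <-> (n %/ 4 <= k /\ k <= (3 * n + 3) %/ 4)%N).
Proof.
move=> t0 ht; have latinL : latin_square (twisted_square 0 0 0 0).
  exact: twisted_square_latin.
exists (twisted_square 0 0 0 0); split=> //.
apply: (odd_plex_range latinL).
  by move=> k P; exact: (kplex_lower_bound excess_untwisted).
have nE : n = (8 * t)%N by rewrite nh ht -muln2; clear; lia.
move=> k ok nk kh; have kE : k = (t + (k./2 - t)).*2.+1.
  by apply: odd_half_index => //; move: nk; rewrite nE; clear; lia.
move: (k./2 - t)%N kE => j kE.
have hn : (h < n)%N by rewrite nE ht; move: t0; clear; lia.
have oh : ~~ odd h by rewrite ht oddM.
pose nu := strand h h h.
pose ih : Z := h%:R; have ihE : nat_of_ord ih = h by exact: natr_small.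
have nuh : nu ih = (0, 0).
  by rewrite /nu /strand ihE /cyc ltnn eqxx addn0 natrD half_half.
have lab0 : label ((0, 0) : Z * Z) = 2%N.
  by apply: labelE; [ring | rewrite nE; move: t0; clear; lia].
(* The cells with [rho = 0] and [rho = 2] both lie in even columns, so the actual rows of the strand
   are its first coordinates permuted by [rowswap]. *)
have rowP (i : Z) : (h + i)%:R = 0 :> Z \/ (h + i)%:R = 2%:R :> Z ->
    ~~ oddZ (nu i).2.
  have ne j1 : (h + j1 < n + n)%N -> (h + j1)%:R = 0 :> Z \/
     (h + j1)%:R = 2%:R :> Z -> j1 = h \/ j1 = (h + 2)%N.
    move=> jn [e|e].
      case: (@natr_eq_lt2 _ 0 jn isT e) => {}e; first by case: h h_gt1 e.
      by left; move: e; rewrite nE ht; clear; lia.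
    have n2 : (2 < n)%N by rewrite nE; move: t0; clear; lia.
    case: (@natr_eq_lt2 _ 2 jn n2 e); rewrite ?nE ?ht; move: t0; clear; lia.
  move=> /ne[|e|e].
  - by apply: (@leq_ltn_trans (n + i)); rewrite ?ltn_add2l // leq_add2r ltnW.
  - by rewrite /nu /strand oddZ_nat e /cyc ltnn eqxx !oddD (negPf oh).
  - rewrite /nu /strand oddZ_nat e cyc_gt; last by clear; lia.
    by rewrite !oddD (negPf oh).
have actE (i : Z) : act (nu i) = rowswap (h + i)%:R.
  have [e|r0] := eqVneq ((h + i)%:R : Z) 0.
    by rewrite /act (negPf (rowP i (or_introl e))).
  have [e|r2] := eqVneq ((h + i)%:R : Z) 2%:R.
    by rewrite /act (negPf (rowP i (or_intror e))).
  by rewrite act_id // rowswap_id.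
have sndI : injective (fun i => (nu i).2) by apply: strand_snd_inj.
have actI : injective (fun i => act (nu i)).
  by move=> i1 i2 /=; rewrite !actE => /perm_inj /(@strand_fst_inj h h h).
have row_inj i1 i2 : (nu i1).1 = (nu i2).1 -> i1 = i2.
  exact: strand_fst_inj.
(* The term [delta h] is repeated on the left because both [f] and the missing symbol are [h]; one
   copy cancels against [y = h]. *)
have symE s : (\sum_i (sym (nu i) == s) + delta h%:R s + delta h%:R s =
               1 + delta 0 s + delta h%:R s)%N.
  have := @sum_sym_strand h h h s (or_introl erefl).
  have -> : (h + h + h + h + h + (h < h))%:R = h%:R :> Z.
    by rewrite ltnn addn0; apply: (@natr_mod_eq _ _ 2); rewrite nE ht; clear; lia.
  have -> : (h + h + h + h)%:R = 0 :> Z.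
    by apply: (@natr_mod_eq _ 0 2); rewrite nE ht; clear; lia.
  by move=> ->.
have labE i : nu i != (0, 0) -> (h <= label (nu i) <= h + 3)%N.
  rewrite -nuh => ne; have {}ne : nat_of_ord i != h.
    by rewrite -ihE; apply: contra ne => /eqP /ord_inj ->.
  rewrite /nu /strand (@labelE _ _ (h + 2 + (i < h))%N).
  - by case: ltnP; clear; lia.
  - rewrite /cyc; case: ltngtP ne => //= _ _; rewrite !natrD.
      by rewrite -natr1; ring.
    by ring.
  - have h3 : (h + 3 < n)%N by rewrite nE ht; move: t0; clear; lia.
    by apply: leq_ltn_trans h3; case: ltnP; clear; lia.
pose i1 : Z := (n - 1)%:R.
have i1E : nat_of_ord i1 = (n - 1)%N by apply: natr_small; clear; lia.
have nu1 : nu i1 = (h%:R - 1, - 1).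
  rewrite /nu /strand i1E cyc_gt; last by rewrite nE ht; move: t0; clear; lia.
  by rewrite !natrD natr_pred half_half add0r.
have small_neq (a b : nat) : (a < n)%N -> (b < n)%N -> a != b ->
    (a%:R : Z) != b%:R by move=> an bn; rewrite natr_eqE.
have h1E : h%:R - 1 = (h - 1)%:R :> Z by rewrite natrB // ht; move: t0; clear; lia.
have h2E : h%:R + 1 = (h + 1)%:R :> Z by rewrite natrD.
have corner : (0 < h)%N ->
    [/\ (h%:R - 1, h%:R + h%:R - 1) \in [set nu i | i : Z],
    (h%:R - 1, h%:R + h%:R - 2%:R) \notin [set nu i | i : Z] &
    (h%:R + 1, h%:R + h%:R - 1) \notin [set nu i | i : Z]].
  move=> _; rewrite half_half !sub0r; split.
  - by apply/imsetP; exists i1.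
  - apply/imsetP => -[i _ e]; have ii : i = i1 by apply: row_inj; rewrite nu1 -e.
    move: (congr1 snd e); rewrite ii nu1 /= => /oppr_inj /eqP.
    by rewrite eq_sym (@natr_eqE 1 2) // nE; move: t0; clear; lia.
  - apply/imsetP => -[i _ e]; have ii : i = i1 by apply: sndI; rewrite nu1 -e.
    move: (congr1 fst e); rewrite ii nu1 /= => /addrI /eqP.
    by rewrite -subr_eq0 opprK (negPf two_neq0).
have [|||||||||Q [actQ sndQ symQ _]] := @plexes_of_strand h t h%:R (0, 0) h%:R nu
    ht _ half_half _ _ _ _ _ _ actI sndI symE labE corner j (h + 4).
- by rewrite nE ht; move: t0; clear; lia.
- by rewrite h1E; apply: (small_neq _ 0%N); rewrite ?nE ?ht; move: t0; clear; lia.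
- by rewrite h1E; apply: (small_neq _ 2%N); rewrite ?nE ?ht; move: t0; clear; lia.
- by rewrite h2E; apply: (small_neq _ 0%N); rewrite ?nE ?ht; move: t0; clear; lia.
- by rewrite h2E; apply: (small_neq _ 2%N); rewrite ?nE ?ht; move: t0; clear; lia.
- by left.
- by rewrite lab0; clear; lia.
- by [].
- by move: kE kh ok; rewrite nE ht -!muln2; move: t0; clear; lia.
by rewrite kE; apply: (has_kplex_untwisted actQ sndQ).
Qed.

End CyclicSquare.

(** * The 3-plex of order 6, checked by computation *)

Section Order6.

(** Entry [r] of the list holds the columns chosen in row [r]. *)
Definition plex6 (r c : 'I_6) : bool :=
  nat_of_ord c \in nth [::] [:: [:: 0; 1; 2]; [:: 0; 1; 3]; [:: 3; 4; 5];
    [:: 2; 3; 5]; [:: 2; 4; 5]; [:: 0; 1; 4]] r.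

(** The twisted square tabulated on naturals, so that symbol counts evaluate; the default values are
    never reached at indices below 6. *)
Definition square6 (r c : nat) : nat :=
  nth 0 (nth [::] [:: [:: 2; 1; 4; 3; 0; 5]; [:: 1; 3; 2; 4; 5; 0];
    [:: 0; 2; 3; 5; 4; 1]; [:: 3; 4; 5; 0; 1; 2]; [:: 4; 5; 0; 1; 2; 3];
    [:: 5; 0; 1; 2; 3; 4]] r) c.

Let tperm_if (x y z : 'I_6) :
  tperm x y z = if z == x then y else if z == y then x else z.
Proof.
by case: tpermP => [->|->|/eqP/negPf -> /eqP/negPf ->]; rewrite ?eqxx //;
  case: eqP.
Qed.

Let square6E (r c : 'I_6) :
  nat_of_ord (@twisted_square 4 1 2%:R 1 (1 + 1) r c)%R = square6 r c.
Proof.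
rewrite /twisted_square /base_square /act /rowswap !tperm_if.
case: r => -[|[|[|[|[|[|//]]]]]] ?; case: c => -[|[|[|[|[|[|//]]]]]] ?;
  by vm_compute.
Qed.

Lemma order6_has_3plex :
  has_kplex (@twisted_square 4 1 2%:R 1 (1 + 1))%R 3.
Proof.
have cntE (phi : 'I_6 * 'I_6 -> 'I_6) (psi : nat -> nat -> nat) (z : 'I_6) :
    (forall r c : 'I_6, psi r c = phi (r, c)) ->
    #|[set q in [set q | plex6 q.1 q.2] | phi q == z]| =
    \sum_(r < 6) \sum_(c < 6) (plex6 r c && (psi r c == z)).
  move=> psiE; rewrite -sum1_card big_mkcond pair_bigA /=.
  apply: eq_bigr => -[r c] _; rewrite !inE /= psiE (inj_eq val_inj).
  by case: (plex6 r c); case: (phi (r, c) == z).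
exists [set q | plex6 q.1 q.2]; split.
- rewrite -sum1_card big_mkcond /=.
  rewrite (eq_bigr (fun q => (plex6 q.1 q.2 : nat))); last first.
    by move=> q _; rewrite inE; case: plex6.
  rewrite -(pair_bigA _ (fun r c => (plex6 r c : nat))) /=.
  by rewrite !big_ord_recl !big_ord0.
- move=> r; apply: etrans (cntE fst (fun r c => r) r _) _ => //.
  by case: r => -[|[|[|[|[|[|//]]]]]] ?; rewrite !big_ord_recl !big_ord0.
- move=> c; apply: etrans (cntE snd (fun r c => c) c _) _ => //.
  by case: c => -[|[|[|[|[|[|//]]]]]] ?; rewrite !big_ord_recl !big_ord0.
- move=> s; apply: etrans (cntE
    (fun q => twisted_square 1 2%:R 1 (1 + 1) q.1 q.2)%R square6 s _) _.
    by move=> r c; rewrite square6E.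
  by case: s => -[|[|[|[|[|[|//]]]]]] ?; rewrite !big_ord_recl !big_ord0.
Qed.

End Order6.

Theorem theorem5p3 (n : nat) (hn_even : ~~ odd n) (hn : 2 < n) :
  exists L : 'I_n -> 'I_n -> 'I_n,
    latin_square L /\
    (forall k : nat, odd k ->
       (has_kplex L k <-> (n %/ 4 <= k /\ k <= (3 * n + 3) %/ 4))).
Proof.
case: n hn_even hn => [|[|p]] // n_even n_gt2.
have nh : p.+2 = (p.+2)./2.*2.
  by have := odd_double_half p.+2; rewrite (negPf n_even).
move: (p.+2)./2 nh => h nh; have h_gt1 : 1 < h by lia.
(* The residue of [h] modulo 4 determines that of [n = 2h] modulo 8. *)
have hE := divn_eq h 4; have := ltn_pmod h (isT : 0 < 4).
move: (h %/ 4) (h %% 4) hE => t [|[|[|[|//]]]] hE _; rewrite mulnC in hE.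
- rewrite addn0 in hE; apply: (case_n0mod8 nh h_gt1 _ hE); by lia.
- by apply: (case_n2mod8 nh h_gt1 _ hE); lia.
- exact: (case_n4mod8 nh h_gt1 hE).
apply: (case_n6mod8 nh h_gt1 hE) => t0; rewrite t0 muln0 in hE.
have p4 : p = 4 by lia.
by move: n_even n_gt2 nh; rewrite p4 => *; exact: order6_has_3plex.
Qed.
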